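(* Let $k$ be an algebraically closed field, let $\Lambda$ be a finite dimensional symmetric $k$-algebra with no semisimple summand, and let $C_0$ and $D_0$ be indecomposable objects in $D^b(\Lambda\text{-proj})$ that lie on the rim of their Auslander-Reiten quiver components. Let $C_m$ and $D_n$ ($m,n\geq 0$) denote the objects at distance $m$, respectively $n$, from the rim in the components of $C_0$, respectively $D_0$, labelled as described in the context. Then the values of the form $\langle C_m,D_n\rangle^t$ on objects in the same components as $C_0$ and $D_0$ are entirely determined by knowing $\langle C_0,D_0\rangle^t$. Specifically, if $C_0$ and $D_0$ lie in different quiver components then $$\langle C_m,D_n\rangle^t=\sigma_m\overline{\sigma}_n\langle C_0,D_0\rangle^t,$$ while $$\langle C_m,C_n\rangle^t=\sigma_m\overline{\sigma}_n\left(\langle C_0,C_0\rangle^t-\frac{(1+t)(1-t^{\mu})}{1-t^{\mu+1}}\right),$$ where $\mu$ is the maximum of $m$ and $n$.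
   Context: $D^b(\Lambda\text{-proj})$ is the homotopy category of perfect complexes, i.e. of finite complexes of finitely generated projective $\Lambda$-modules. $\Lambda$ is symmetric if $\Lambda\cong\operatorname{Hom}_k(\Lambda,k)$ as bimodules; ''no semisimple summand'' means no nonzero algebra direct factor of $\Lambda$ is semisimple. For perfect complexes $M,N$, $$\langle M,N\rangle^t:=\sum_{i\in\mathbb{Z}}t^i\dim_k\operatorname{Hom}_{D^b(\Lambda\text{-proj})}(M,N[i])\in\mathbb{Z}[t,t^{-1}].$$ $\sigma_r:=1+t+t^2+\cdots+t^r$ for $r\geq 1$, $\sigma_0:=1$, and $\overline{\phantom{x}}$ is the ring automorphism of $\mathbb{Z}[t,t^{-1}]$ (and of $\mathbb{Q}(t)$) with $t\mapsto t^{-1}$; $\overline{\sigma}_n$ denotes $\overline{\sigma_n}$. An Auslander-Reiten triangle is a distinguished triangle $X\to Y\xrightarrow{\beta}Z\xrightarrow{\gamma}X[1]$ with $X,Z$ indecomposable, $\gamma\neq 0$, such that every morphism $W\to Z$ that is not a split epimorphism factors through $\beta$. It is known (Happel) that $D^b(\Lambda\text{-proj})$ has Auslander-Reiten triangles, and since $\Lambda$ is symmetric they have the form $X\to Y\to X[1]\to X[1]$; it is known (Wheeler) that, as $\Lambda$ has no semisimple summand, all components of the Auslander-Reiten quiver have the form $\mathbb{Z}A_\infty$. An indecomposable $Z$ lies on the rim if in the Auslander-Reiten triangle $X\to Y\to Z\to X[1]$ the object $Y$ is indecomposable. Labelling: in a component, the rim objects are the shifts $C_0[j]$, $j\in\mathbb{Z}$,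 of a single object $C_0$, and the objects at distance $n$ from the rim are the shifts of an indecomposable $C_n$, chosen so that there is a chain of irreducible morphisms $C_0\to C_1\to\cdots\to C_n$. Thus the Auslander-Reiten triangles are $C_0[-1]\to C_1[-1]\to C_0\to C_0$ and, for $n\geq 1$, $C_n[-1]\to C_{n-1}\oplus C_{n+1}[-1]\to C_n\to C_n$. The objects $D_n$ are labelled from $D_0$ in the same way. *)

(* Defs.v *)
From HB Require Import structures.
From mathcomp Require Import all_boot all_order all_algebra all_field.
From mathcomp Require Import boolp classical_sets cardinality fsbigop.

Set Implicit Arguments.
Unset Strict Implicit.
Unset Printing Implicit Defensive.

Import Order.TTheory GRing.Theory Num.Theory.
Local Open Scope ring_scope.

Section Algebra.
Variables (k : fieldType) (A : falgType k).

(* The bimodule structure on Hom_k(A, k) is (a phi b)(y) = phi (b y a). *)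
Definition symmetric_algebra : Prop :=
  exists2 phi : {linear A -> 'Hom(A, k^o)}, bijective phi &
    forall a b x y : A, phi (a * x * b) y = phi x (b * y * a).

Definition left_ideal (I : {vspace A}) : Prop :=
  forall a x : A, x \in I -> a * x \in I.

(* For a central idempotent e, the left ideals of the algebra A e are the left
   ideals of A contained in A e; the algebra A e is semisimple when each of
   them has a complement. *)
Definition semisimple_factor (e : A) : Prop :=
  let Ae := (fullv * <[e]>)%VS in
  forall I : {vspace A}, left_ideal I -> (I <= Ae)%VS ->
    exists J : {vspace A},
      [/\ left_ideal J, (I + J)%VS = Ae & (I :&: J)%VS = 0%VS].

(* The direct factors of the algebra A are the A e with e a central
   idempotent. *)
Definition no_semisimple_summand : Prop :=
  forall e : A, e * e = e -> (forall x, e * x = x * e) -> e != 0 ->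
    ~ semisimple_factor e.

End Algebra.

Section Projective.
Variable A : nzRingType.

Definition finitely_generated (P : lmodType A) : Prop :=
  exists (n : nat) (g : 'I_n -> P),
    forall x, exists a : 'I_n -> A, x = \sum_i a i *: g i.

Definition projective (P : lmodType A) : Prop :=
  forall (M N : lmodType A) (p : {linear M -> N}) (f : {linear P -> N}),
    (forall y, exists x, p x = y) ->
    exists g : {linear P -> M}, forall x, p (g x) = f x.

Lemma finitely_generatedX (P Q : lmodType A) :
  finitely_generated P -> finitely_generated Q ->
  finitely_generated (P * Q)%type.
Proof.
move=> [n [g gP]] [m [h hQ]]; exists (n + m)%N.
exists (fun i => match split i with inl j => (g j, 0) | inr j => (0, h j) end).
move=> [x y]; have [a ->] := gP x; have [b ->] := hQ y.
exists (fun i => match split i with inl j => a j | inr j => b j end).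
have fstS I (r : seq I) (F : I -> P * Q) :
    (\sum_(i <- r) F i).1 = \sum_(i <- r) (F i).1.
  exact: (big_morph (fun u : P * Q => u.1)).
have sndS I (r : seq I) (F : I -> P * Q) :
    (\sum_(i <- r) F i).2 = \sum_(i <- r) (F i).2.
  exact: (big_morph (fun u : P * Q => u.2)).
have splitL i : split (lshift m i) = inl i := unsplitK (inl i).
have splitR i : split (rshift n i) = inr i := unsplitK (inr i).
apply: injective_projections; rewrite ?fstS ?sndS big_split_ord /=.
  rewrite [X in _ + X]big1 ?addr0 => [|i _]; last by rewrite splitR scaler0.
  by apply: eq_bigr => i _; rewrite splitL.
rewrite [X in X + _]big1 ?add0r => [|i _]; last by rewrite splitL scaler0.
by apply: eq_bigr => i _; rewrite splitR.
Qed.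

Section Incl.
Variables P Q : lmodType A.
Definition inclL (x : P) : (P * Q)%type := (x, 0).
Definition inclR (y : Q) : (P * Q)%type := (0, y).
Fact inclL_linear : linear inclL.
Proof. by move=> a x y; congr pair; rewrite /= scaler0 addr0. Qed.
Fact inclR_linear : linear inclR.
Proof. by move=> a x y; congr pair; rewrite /= scaler0 addr0. Qed.
HB.instance Definition _ :=
  GRing.isLinear.Build A P (P * Q)%type *:%R inclL inclL_linear.
HB.instance Definition _ :=
  GRing.isLinear.Build A Q (P * Q)%type *:%R inclR inclR_linear.
End Incl.

Section Copair.
Variables (P Q M : lmodType A) (u : {linear P -> M}) (v : {linear Q -> M}).
Definition copair (z : (P * Q)%type) : M := u z.1 + v z.2.
Fact copair_linear : linear copair.
Proof.
by move=> a x y; rewrite /copair /= !linearP scalerDr addrACA.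
Qed.
HB.instance Definition _ :=
  GRing.isLinear.Build A (P * Q)%type M *:%R copair copair_linear.
End Copair.

Lemma projectiveX (P Q : lmodType A) :
  projective P -> projective Q -> projective (P * Q)%type.
Proof.
move=> pP pQ M N p f ps.
have [u uE] := pP _ _ p (f \o @inclL P Q) ps.
have [v vE] := pQ _ _ p (f \o @inclR P Q) ps.
exists (copair u v) => -[x y]; rewrite /= /copair linearD uE vE /= -linearD.
by congr (f _); congr pair; rewrite /= ?addr0 ?add0r.
Qed.

End Projective.

(* Complexes are cohomological and graded by all integers. The differential has
   an entry for every pair of degrees, which vanishes off j = i + 1; shifts
   then need no transport between the degrees. *)
Record perf (k : fieldType) (A : falgType k) := Perf {
  term :> int -> lmodType A;
  diff : forall i j : int, {linear term i -> term j};
  diff_shape : forall i j, j != i + 1 -> forall x, diff i j x = 0;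
  diff_sq : forall i j l x, diff j l (diff i j x) = 0;
  term_fg : forall i, finitely_generated (term i);
  term_proj : forall i, projective (term i);
  term_bounded : exists b : nat,
    forall i : int, b%:Z < `|i| -> forall x : term i, x = 0 }.

Section Perfect.
Variables (k : fieldType) (A : falgType k).
Implicit Types (M N X Y Z W : perf A).

Record chain_map M N := ChainMap {
  cmap :> forall i : int, {linear M i -> N i};
  cmap_diff : forall i j x, cmap j (diff M i j x) = diff N i j (cmap i x) }.

(* Stated for an arbitrary family of maps, so that linear combinations of chain
   maps need not be bundled. *)
Definition nullhomotopic M N (u : forall i : int, M i -> N i) : Prop :=
  exists h : forall i j : int, {linear M i -> N j},
    forall i x, u i x =
      diff N (i - 1) i (h i (i - 1) x) + h (i + 1) i (diff M i (i + 1) x).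

Definition homotopic M N (f g : chain_map M N) : Prop :=
  nullhomotopic (fun i x => f i x - g i x).

Program Definition cid M : chain_map M M :=
  @ChainMap M M (fun i => idfun) _.

Program Definition ccomp M N X (g : chain_map N X) (f : chain_map M N) :
  chain_map M X := @ChainMap M X (fun i => g i \o f i) _.
Next Obligation. by rewrite /= !cmap_diff. Qed.

Definition hequiv M N (f : chain_map M N) : Prop :=
  exists g : chain_map N M,
    homotopic (ccomp g f) (cid M) /\ homotopic (ccomp f g) (cid N).

(* isomorphism in the homotopy category *)
Definition hiso M N : Prop := exists f : chain_map M N, hequiv f.

Definition hzero M : Prop := nullhomotopic (fun i => cid M i).

Section Shift.
Variables (M : perf A) (n : int).

Definition shift_diff (i j : int) (x : M (i + n)) : M (j + n) :=
  (-1) ^+ `|n|%N *: diff M (i + n) (j + n) x.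

Fact shift_diff_linear i j : linear (@shift_diff i j).
Proof.
by move=> a x y; rewrite /shift_diff linearP scalerDr !scalerA commr_sign.
Qed.
HB.instance Definition _ i j :=
  GRing.isLinear.Build A (M (i + n)) (M (j + n)) *:%R (@shift_diff i j)
    (@shift_diff_linear i j).

Fact shift_shape i j : j != i + 1 -> forall x, @shift_diff i j x = 0.
Proof.
move=> ij x; rewrite /shift_diff diff_shape ?scaler0 //.
by rewrite addrAC (inj_eq (addIr n)).
Qed.

Fact shift_sq i j l x : @shift_diff j l (@shift_diff i j x) = 0.
Proof. by rewrite /shift_diff linearZ /= diff_sq !scaler0. Qed.

Fact shift_bounded : exists b : nat,
  forall i : int, b%:Z < `|i| -> forall x : M (i + n), x = 0.
Proof.
have [b bP] := term_bounded M; exists (b + `|n|)%N => i lt_i x; apply: bP.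
rewrite -(ltrD2r `|n|); apply: (lt_le_trans lt_i).
by rewrite -{1}[i](addrK n) ler_normB.
Qed.

Definition shift : perf A :=
  @Perf k A (fun i => M (i + n)) (fun i j => @shift_diff i j)
    shift_shape shift_sq (fun i => term_fg M (i + n))
    (fun i => @term_proj _ _ M (i + n)) shift_bounded.

End Shift.
Section DirectSum.
Variables M N : perf A.

Definition dsum_diff (i j : int) (z : M i * N i) : M j * N j :=
  (diff M i j z.1, diff N i j z.2).

Fact dsum_diff_linear i j : linear (@dsum_diff i j).
Proof. by move=> a x y; rewrite /dsum_diff !linearP. Qed.
HB.instance Definition _ i j :=
  GRing.isLinear.Build A (M i * N i)%type (M j * N j)%type *:%R (@dsum_diff i j)
    (@dsum_diff_linear i j).

Fact dsum_shape i j : j != i + 1 -> forall x, @dsum_diff i j x = 0.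
Proof. by move=> ij x; rewrite /dsum_diff !diff_shape. Qed.

Fact dsum_sq i j l x : @dsum_diff j l (@dsum_diff i j x) = 0.
Proof. by rewrite /dsum_diff /= !diff_sq. Qed.

Fact dsum_bounded : exists b : nat,
  forall i : int, b%:Z < `|i| -> forall x : M i * N i, x = 0.
Proof.
have [b bP] := term_bounded M; have [c cP] := term_bounded N.
exists (b + c)%N => i lt_i [x y]; apply: injective_projections => /=.
  by apply: bP; apply: le_lt_trans lt_i; rewrite lez_nat leq_addr.
by apply: cP; apply: le_lt_trans lt_i; rewrite lez_nat leq_addl.
Qed.

Definition dsum : perf A :=
  @Perf k A (fun i => (M i * N i)%type) (fun i j => @dsum_diff i j)
    dsum_shape dsum_sq
    (fun i => finitely_generatedX (term_fg M i) (term_fg N i))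
    (fun i => projectiveX (@term_proj _ _ M i) (@term_proj _ _ N i))
    dsum_bounded.

End DirectSum.

(* The (i, j) entry of the identity of the graded module underlying M. *)
Definition along M (i j : int) (x : M i) : M j :=
  if i =P j is ReflectT e then ecast l (M l) e x else 0.

Lemma along_id M i x : @along M i i x = x.
Proof. by rewrite /along; case: eqP => // e; rewrite eq_axiomK. Qed.

Lemma along_neq M i j x : i != j -> @along M i j x = 0.
Proof. by rewrite /along; case: eqP. Qed.

Fact along_linear M i j : linear (@along M i j).
Proof.
move=> a x y; have [ij | ij] := eqVneq i j.
  by case: j / ij; rewrite !along_id.
by rewrite !along_neq // scaler0 addr0.
Qed.
HB.instance Definition _ M i j :=
  GRing.isLinear.Build A (M i) (M j) *:%R (@along M i j) (@along_linear M i j).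

Section Cone.
Variables (M N : perf A) (f : chain_map M N).

(* In degree i the cone is M^{i+1} (+) N^i, and its differential sends (x, y) to
   (- d x, f x + d y). *)
Definition cone_diff (i j : int) (z : shift M 1 i * N i) : shift M 1 j * N j :=
  (diff (shift M 1) i j z.1, along j (f (i + 1) z.1) + diff N i j z.2).

Fact cone_diff_linear i j : linear (@cone_diff i j).
Proof.
move=> a x y; rewrite /cone_diff; apply: injective_projections.
  by rewrite /= linearP.
by rewrite /= !linearP /= scalerDr addrACA.
Qed.
HB.instance Definition _ i j :=
  GRing.isLinear.Build A (shift M 1 i * N i)%type (shift M 1 j * N j)%type
    *:%R (@cone_diff i j) (@cone_diff_linear i j).

Fact cone_shape i j : j != i + 1 -> forall x, @cone_diff i j x = 0.
Proof.
move=> ij x; rewrite /cone_diff !diff_shape // along_neq ?addr0 //.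
by rewrite eq_sym.
Qed.

Fact cone_sq i j l x : @cone_diff j l (@cone_diff i j x) = 0.
Proof.
have [ej | nj] := eqVneq j (i + 1); last by rewrite (cone_shape nj) linear0.
have [el | nl] := eqVneq l (j + 1); last by rewrite cone_shape.
subst l; subst j; rewrite /cone_diff; apply: injective_projections.
  exact: (@diff_sq _ _ (shift M 1)).
rewrite /= !along_id linearD /= diff_sq addr0 /shift_diff expr1 scaleN1r.
by rewrite linearN /= cmap_diff addNr.
Qed.

Definition cone : perf A :=
  @Perf k A (fun i => (shift M 1 i * N i)%type) (fun i j => @cone_diff i j)
    cone_shape cone_sq
    (fun i => finitely_generatedX (term_fg (shift M 1) i) (term_fg N i))
    (fun i => projectiveX (@term_proj _ _ (shift M 1) i) (@term_proj _ _ N i))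
    (dsum_bounded (shift M 1) N).

Program Definition cone_in : chain_map N cone :=
  @ChainMap _ _ (fun i => @inclR A (shift M 1 i) (N i)) _.
Next Obligation.
rewrite /= /cone_diff /inclR; apply: injective_projections => /=.
  by rewrite linear0.
by rewrite !linear0 add0r.
Qed.

Program Definition cone_out : chain_map cone (shift M 1) :=
  @ChainMap _ _ (fun i => fst) _.

End Cone.

Program Definition shift_map M N (f : chain_map M N) (n : int) :
  chain_map (shift M n) (shift N n) :=
  @ChainMap _ _ (fun i => f (i + n)) _.
Next Obligation. by rewrite /= /shift_diff linearZ /= cmap_diff. Qed.

Definition distinguished X Y Z (u : chain_map X Y) (v : chain_map Y Z)
    (w : chain_map Z (shift X 1)) : Prop :=
  exists (X' Y' : perf A) (f : chain_map X' Y') (a : chain_map X X')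
    (b : chain_map Y Y') (c : chain_map Z (cone f)),
    [/\ hequiv a, hequiv b & hequiv c] /\
    [/\ homotopic (ccomp b u) (ccomp f a),
        homotopic (ccomp c v) (ccomp (cone_in f) b) &
        homotopic (ccomp (shift_map a 1) w) (ccomp (cone_out f) c)].

Definition indecomposable M : Prop :=
  ~ hzero M /\ forall X Y, hiso M (dsum X Y) -> hzero X \/ hzero Y.

Definition split_epi M N (f : chain_map M N) : Prop :=
  exists s : chain_map N M, homotopic (ccomp f s) (cid N).

Definition split_mono M N (f : chain_map M N) : Prop :=
  exists r : chain_map N M, homotopic (ccomp r f) (cid M).

Definition AR_triangle X Y Z (u : chain_map X Y) (v : chain_map Y Z)
    (w : chain_map Z (shift X 1)) : Prop :=
  [/\ distinguished u v w,
      indecomposable X /\ indecomposable Z,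
      ~ nullhomotopic (fun i => w i) &
      forall (W : perf A) (f : chain_map W Z), ~ split_epi f ->
        exists g : chain_map W Y, homotopic f (ccomp v g)].

Definition has_AR_triangle X Y Z : Prop :=
  exists (u : chain_map X Y) (v : chain_map Y Z) (w : chain_map Z (shift X 1)),
    AR_triangle u v w.

Definition irreducible_map M N (f : chain_map M N) : Prop :=
  [/\ ~ split_mono f, ~ split_epi f &
      forall X (g : chain_map M X) (h : chain_map X N),
        homotopic f (ccomp h g) -> split_mono g \/ split_epi h].

Definition arrow M N : Prop :=
  [/\ indecomposable M, indecomposable N &
      exists f : chain_map M N, irreducible_map f].

(* walks of length n in the underlying graph of the quiver, whose vertices are
   isomorphism classes *)
Fixpoint walk (n : nat) M N : Prop :=
  if n is n'.+1 then exists X, walk n' M X /\ (arrow X N \/ arrow N X)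
  else hiso M N.

Definition same_component M N : Prop := exists n, walk n M N.

Definition on_rim Z : Prop :=
  indecomposable Z /\
  exists X Y, has_AR_triangle X Y Z /\ indecomposable Y.

Definition rim_distance M (n : nat) : Prop :=
  (exists R, on_rim R /\ walk n R M) /\
  forall m, (m < n)%N -> ~ exists R, on_rim R /\ walk m R M.

(* C labels the Auslander-Reiten component of C 0: up to isomorphism, the
   objects of the component at distance n from the rim are the shifts of C n.
   The last two fields fix the component to be the Z A_infty with translation
   [-1]; a triangle starting at (C n)[-1] has (C n)[-1][1], isomorphic to C n,
   as its fourth term. *)
Record labelling (C : nat -> perf A) : Prop := Labelling {
  labelling_indec : forall n, indecomposable (C n);
  labelling_level : forall n X,
    same_component (C 0%N) X /\ rim_distance X n <->
    exists j : int, hiso X (shift (C n) j);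
  labelling_irr : forall n, arrow (C n) (C n.+1);
  labelling_AR0 :
    has_AR_triangle (shift (C 0%N) (-1)) (shift (C 1%N) (-1)) (C 0%N);
  labelling_ARS : forall n,
    has_AR_triangle (shift (C n.+1) (-1))
      (dsum (C n) (shift (C n.+2) (-1))) (C n.+1) }.

(* The scalars of k act through c%:A = c *: 1 : A. *)
Definition lincomb M N (d : nat) (c : 'rV[k]_d) (b : 'I_d -> chain_map M N)
    (i : int) (x : M i) : N i :=
  \sum_(j < d) (c 0 j)%:A *: b j i x.

(* b is a basis of the space of morphisms M -> N of the homotopy category. *)
Definition hom_basis M N (d : nat) (b : 'I_d -> chain_map M N) : Prop :=
  forall f : chain_map M N, exists! c : 'rV[k]_d,
    nullhomotopic (fun i x => f i x - lincomb c b x).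

Definition hom_dim M N : nat :=
  xget 0%N [set d : nat | exists b : 'I_d -> chain_map M N, hom_basis b]%classic.

End Perfect.

Definition Qt : fieldType := {fraction {poly rat}}.

Definition t : Qt := tofrac 'X.

(* The sum over all integers has finite support. *)
Definition pairing (k : fieldType) (A : falgType k) (M N : perf A) : Qt :=
  \sum_(i \in [set: int]) t ^ i *+ hom_dim M (shift N i).

Definition sigma (r : nat) : Qt := \sum_(i < r.+1) t ^+ i.

(* The image of p under t |-> t^-1. *)
Definition eval_inv (p : {poly rat}) : Qt :=
  (map_poly (fun c => tofrac c%:P) p).[t^-1].

(* The automorphism t |-> t^-1, computed on a numerator and a denominator. *)
Definition bar (x : Qt) : Qt :=
  let r := repr x in eval_inv (frac r).1 / eval_inv (frac r).2.

(* Main.v *)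
(** All morphism spaces of the homotopy category are finite dimensional over k, and
a cone gives long exact sequences in both variables. Let X -> Y -> Z -w-> X[1] be
an Auslander-Reiten triangle with X[1] isomorphic to Z. For W indecomposable, w
kills every map W -> Z that is not an isomorphism, and since k is algebraically
closed every endomorphism of Z is a scalar plus one that is killed by w. So
w_* : Hom(W, Z) -> Hom(W, X[1]) has rank 1 if W is isomorphic to Z and rank 0
otherwise, and dim Hom(W, Y) is dim Hom(W, X) + dim Hom(W, Z) minus two such
ranks. The endomorphisms of Z killed by w are the non-units, so End(Z) is local;
this yields the dual lifting property at X, and the same count for Hom(-, V).
For the labelled components the counts are three-term recurrences in n and in m
for <C_m, D_n>^t, with a correction term exactly when C_m is isomorphic to a shift
of D_n; within one component this happens only for m = n and the trivial shift.
The closed formulas are the unique solution. *)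
Require Import Defs.
From HB Require Import structures.
From mathcomp Require Import all_boot all_order all_algebra all_field.
From mathcomp Require Import boolp classical_sets cardinality fsbigop.
From mathcomp Require Import zify ring.

Set Implicit Arguments.
Unset Strict Implicit.
Unset Printing Implicit Defensive.

Import Order.TTheory GRing.Theory Num.Theory.
Local Open Scope ring_scope.

Reserved Notation "g \oh f" (at level 40, left associativity).

(** The factor 1 + t has one source. With X = Z[-1] the two outer terms of the count, taken over all
    shifts, are <W, Z> and t <W, Z>, and the two ranks are nonzero in degrees that differ by one in
    the same way, so the main term and the correction both carry 1 + t. The fraction in the final
    formula only looks rational: its denominator cancels against whichever of sigma_m and the
    conjugate of sigma_n has index mu. For mu = m >= 1, say, what is subtracted is (1 + t)
    sigma_(m-1) times the conjugate of sigma_n. That only the trivial shift contributes rests on the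
    boundedness of the complexes. The definition of an Auslander-Reiten triangle supplies lifting at
    Z alone, so the contravariant count, hence the recurrence in m, has to wait for the dual
    property at X, which uses X[1] isomorphic to Z once more. Morphism spaces are handled in
    coordinates, as row vectors over k in a chosen basis, so that every dimension count becomes an
    identity between matrix ranks. *)

Definition mklin (R : nzRingType) (P Q : lmodType R) (f : P -> Q)
    (fl : linear f) : {linear P -> Q} :=
  HB.pack f (GRing.isLinear.Build R P Q *:%R f fl).

(** * Finite dimensionality of morphism spaces *)

Section Hom.
Variables (k : fieldType) (A : falgType k).
Implicit Types (M N X Y Z W V : perf A).

(** Scalars of [k] act through the centre of [A]; this keeps [k]-linear combinations of [A]-linear
    maps [A]-linear. *)
Lemma scaleA_comm (a : k) (b : A) (P : lmodType A) (x : P) :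
  a%:A *: (b *: x) = b *: (a%:A *: x).
Proof. by rewrite !scalerA mulr_algl mulr_algr. Qed.

Lemma scaleAD (a b : k) (P : lmodType A) (x : P) :
  (a + b)%:A *: x = a%:A *: x + b%:A *: x.
Proof. by rewrite scalerDl scalerDl. Qed.

Lemma scaleAM (a b : k) (P : lmodType A) (x : P) :
  (a * b)%:A *: x = a%:A *: (b%:A *: x).
Proof. by rewrite scalerA mulr_algl scalerA. Qed.

Section Operations.
Variables M N : perf A.

Definition clin_fun (a : k) (f g : chain_map M N) (i : int) (x : M i) : N i :=
  a%:A *: f i x + g i x.

Fact clin_linear a f g i : linear (@clin_fun a f g i).
Proof.
move=> b x y; rewrite /clin_fun !linearP !scalerDr scaleA_comm.
by rewrite addrACA -!scalerDr.
Qed.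
HB.instance Definition _ a f g i :=
  GRing.isLinear.Build A (M i) (N i) *:%R (@clin_fun a f g i)
    (@clin_linear a f g i).

Program Definition clin a f g : chain_map M N :=
  @ChainMap _ _ M N (fun i => @clin_fun a f g i) _.
Next Obligation. by rewrite /= /clin_fun linearP /= !cmap_diff. Qed.

Program Definition czero : chain_map M N :=
  @ChainMap _ _ M N (fun i => \0) _.
Next Obligation. by rewrite /= linear0. Qed.

Fact lincomb_linear d (c : 'rV[k]_d) (b : 'I_d -> chain_map M N) i :
  linear (@lincomb _ _ _ _ _ c b i).
Proof.
move=> a x y; rewrite /lincomb scaler_sumr -big_split; apply: eq_bigr => j _ /=.
by rewrite linearP scalerDr scaleA_comm.
Qed.
HB.instance Definition _ d (c : 'rV[k]_d) (b : 'I_d -> chain_map M N) i :=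
  GRing.isLinear.Build A (M i) (N i) *:%R (@lincomb _ _ _ _ _ c b i)
    (@lincomb_linear d c b i).

Program Definition ccomb d (c : 'rV[k]_d) (b : 'I_d -> chain_map M N) :
  chain_map M N := @ChainMap _ _ M N (fun i => @lincomb _ _ _ _ _ c b i) _.
Next Obligation.
rewrite /= /lincomb linear_sum; apply: eq_bigr => l _ /=.
by rewrite linearZ /= cmap_diff.
Qed.

(* The equation in each degree, free of the arithmetic of indices. *)
Lemma nullP (u : forall i, M i -> N i) :
  nullhomotopic u <-> exists h : forall i j : int, {linear M i -> N j},
    forall p i n x, p + 1 = i -> i + 1 = n ->
      u i x = diff N p i (h i p x) + h n i (diff M i n x).
Proof.
split=> -[h hP]; exists h; last by move=> i x; apply: hP; rewrite ?subrK.
by move=> p i n x pi <-; rewrite (hP i x); have -> : i - 1 = p by rewrite -pi addrK.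
Qed.

Lemma null_lin a (u v w : forall i, M i -> N i) :
  nullhomotopic u -> nullhomotopic v ->
  (forall i x, w i x = a%:A *: u i x + v i x) -> nullhomotopic w.
Proof.
move=> [h hP] [g gP] wE.
pose s i j (x : M i) : N j := a%:A *: h i j x + g i j x.
have slin i j : linear (s i j).
  move=> b x y; rewrite /s !linearP !scalerDr scaleA_comm.
  by rewrite addrACA -!scalerDr.
exists (fun i j => mklin (slin i j)) => i x; rewrite wE hP gP /= /s linearP /=.
by rewrite scalerDr addrACA.
Qed.

Lemma null_ext (u v : forall i, M i -> N i) :
  (forall i x, u i x = v i x) -> nullhomotopic u -> nullhomotopic v.
Proof. by move=> uv [h hP]; exists h => i x; rewrite -uv. Qed.

Lemma null0 : nullhomotopic (fun i (x : M i) => 0 : N i).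
Proof. by exists (fun i j => \0) => i x /=; rewrite linear0 addr0. Qed.

End Operations.


(** Projectivity splits the surjection from a free module given by finitely many generators. Only
    the injectivity of the section is kept: it gives the elements of [P] finitely many coordinates
    in [A]. *)
Lemma fg_proj_section (P : lmodType A) :
  finitely_generated P -> projective P ->
  exists (n : nat) (s : {linear P -> 'rV[A]_n}), forall x, s x = 0 -> x = 0.
Proof.
move=> [n [g gP]] pP; exists n.
pose p (r : 'rV[A]_n) : P := \sum_i r 0 i *: g i.
have plin : linear p.
  move=> a x y; rewrite /p scaler_sumr -big_split; apply: eq_bigr => i _ /=.
  by rewrite !mxE scalerDl scalerA.
have psurj y : exists x, mklin plin x = y.
  have [a ->] := gP y; exists (\row_i a i).
  by apply: eq_bigr => i _; rewrite mxE.
have [s sP] := pP _ _ (mklin plin) idfun psurj.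
by exists s => x sx; rewrite -[x]/(idfun x) -sP sx linear0.
Qed.

(* A chain map is determined by its values on finitely many generators, which
   have finitely many coordinates in a free module. *)
Lemma chain_map_embedding M N :
  exists (V : vectType k) (e : chain_map M N -> V),
    (forall d (c : 'rV[k]_d) (b : 'I_d -> chain_map M N) (f : chain_map M N),
        (forall i x, f i x = lincomb c b x) ->
        e f = \sum_(j < d) c 0 j *: e (b j)) /\
    (forall f : chain_map M N, e f = 0 -> forall i x, f i x = 0).
Proof.
have [r rP] := term_bounded M.
have gen i : {n : nat & {g : 'I_n -> M i |
    forall x, exists a : 'I_n -> A, x = \sum_j a j *: g j}}.
  by have /cid[n /cid[g gP]] := term_fg M i; exists n, g.
have sec i : {n : nat & {s : {linear N i -> 'rV[A]_n} |
    forall x, s x = 0 -> x = 0}}.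
  have /cid[n /cid[s sP]] := fg_proj_section (term_fg N i) (@term_proj _ _ N i).
  by exists n, s.
(* [deg] enumerates the degrees from -r to r, outside of which [M] vanishes. *)
pose deg (l : 'I_(r + r).+1) : int := l%:Z - r%:Z.
pose I := {l : 'I_(r + r).+1 &
  ('I_(projT1 (gen (deg l))) * 'I_(projT1 (sec (deg l))))%type}.
pose e (f : chain_map M N) : {ffun I -> A} := [ffun s : I =>
  sval (projT2 (sec (deg (tag s))))
    (f _ (sval (projT2 (gen (deg (tag s)))) (tagged s).1)) 0 (tagged s).2].
exists {ffun I -> A}, e; split.
  move=> d c b f fE; apply/ffunP => -[l [p q]]; rewrite !ffunE /= fE /lincomb.
  rewrite linear_sum summxE sum_ffunE; apply: eq_bigr => j _.
  by rewrite !ffunE /= linearZ mxE mulr_algl.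
move=> f ef i x; have [lt_i|le_i] := ltP r%:Z `|i|.
  by rewrite (rP i lt_i x) linear0.
have [l li] : exists l : 'I_(r + r).+1, deg l = i.
  have lt_l : (absz (i + r%:Z)%R < (r + r).+1)%N.
    by rewrite ltnS -lez_nat abszE PoszD (le_trans (ler_normD _ _)) // lerD2r.
  exists (Ordinal lt_l); rewrite /deg /= abszE ger0_norm ?addrK //.
  by move: le_i; rewrite ler_norml -subr_ge0 opprK => /andP[].
subst i; have [a ->] := svalP (projT2 (gen (deg l))) x.
rewrite linear_sum big1 // => p _; rewrite linearZ /=.
suff -> : f (deg l) (sval (projT2 (gen (deg l))) p) = 0 by rewrite scaler0.
apply: (svalP (projT2 (sec (deg l)))); apply/rowP => q.
by have /ffunP/(_ (Tagged _ (p, q))) := ef; rewrite !ffunE !mxE.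
Qed.

(** Independence up to homotopy implies independence as chain maps, so the embedding into [V] bounds
    the length of such families; one of maximal length is a basis. *)
Lemma hom_basis_exists M N :
  exists (d : nat) (b : 'I_d -> chain_map M N), hom_basis b.
Proof.
have [V [e [eC e0]]] := chain_map_embedding M N.
pose indep d (b : 'I_d -> chain_map M N) :=
  forall c : 'rV[k]_d, nullhomotopic (@lincomb _ _ _ _ _ c b) -> c = 0.
have bound d (b : 'I_d -> chain_map M N) : indep d b -> (d <= \dim {:V})%N.
  move=> bI; have: free [tuple e (b j) | j < d].
    apply/freeP => c cE j.
    suff /rowP/(_ j): \row_j c j = 0 by rewrite !mxE.
    apply: bI; apply: null_ext (null0 M N) => i x; apply/esym.
    apply: (e0 (ccomb (\row_j c j) b)).
    rewrite (eC _ (\row_j c j) b) // -[RHS]cE; apply: eq_bigr => l _.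
    by rewrite mxE -tnth_nth tnth_mktuple.
  by rewrite /free size_tuple => /eqP <-; apply/dimvS/subvf.
pose D d := `[< exists b : 'I_d -> chain_map M N, indep d b >].
have D0 : exists d, D d.
  exists 0%N; apply/asboolP; exists (fun=> czero M N) => c _.
  by apply/rowP => -[].
have Dub d : D d -> (d <= \dim {:V})%N by move=> /asboolP[b /bound].
case: (ex_maxnP D0 Dub) => d /asboolP[b bI] dmax.
exists d, b => f.
(* By maximality, prepending [f] to [b] creates a relation, and the coefficient of [f] in it is
   nonzero because [b] is independent. *)
have [c [a [a0 cP]]] : exists (c : 'rV[k]_d) (a : k), a != 0 /\
    nullhomotopic (fun i x => a%:A *: f i x + lincomb c b x).
  apply: contrapT => nex.
  pose b' := fun j : 'I_d.+1 => if unlift ord0 j is Some l then b l else f.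
  have/dmax: D d.+1; last by rewrite ltnn.
  apply/asboolP; exists b' => c cN.
  have cE i x : lincomb c b' x =
      (c 0 ord0)%:A *: f i x + lincomb (\row_j c 0 (lift ord0 j)) b x.
    rewrite /lincomb big_ord_recl /b' unlift_none; congr (_ + _).
    by apply: eq_bigr => j _; rewrite liftK mxE.
  have c0 : c 0 ord0 = 0.
    apply/eqP; apply: contrapT => /negP c0; apply: nex.
    exists (\row_j c 0 (lift ord0 j)), (c 0 ord0); split=> //.
    exact: null_ext cN.
  have /bI/rowP cl : nullhomotopic (@lincomb _ _ _ _ _ (\row_j c 0 (lift ord0 j)) b).
    by apply: null_ext cN => i x; rewrite cE c0 !scale0r add0r.
  apply/rowP => j; case: (unliftP ord0 j) => [l ->|->]; last by rewrite c0 mxE.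
  by have := cl l; rewrite !mxE.
have cP' : nullhomotopic (fun i x => f i x - lincomb (- a^-1 *: c) b x).
  apply: (null_lin (a := a^-1)) cP (null0 M N) _ => i x.
  rewrite addr0 scalerDr -scaleAM mulVf // !scale1r; congr (_ + _).
  rewrite /lincomb scaler_sumr -sumrN; apply: eq_bigr => j _.
  by rewrite mxE -scaleAM mulNr !scaleNr opprK.
exists (- a^-1 *: c); split=> // c' c'P.
apply/eqP; rewrite -subr_eq0; apply/eqP/bI.
apply: (null_lin (a := -1)) cP' c'P _ => i x.
rewrite scaleN1r scaleN1r opprB addrA subrK /lincomb -sumrB.
by apply: eq_bigr => j _; rewrite !mxE -scalerBl -scalerBl.
Qed.

End Hom.

(** * Homotopy classes, composition and shifts *)


Section Hom.
Variables (k : fieldType) (A : falgType k).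
Implicit Types (M N X Y Z W V : perf A).

Lemma null_compl M N X (g : chain_map N X) (u : forall i, M i -> N i) :
  nullhomotopic u -> nullhomotopic (fun i x => g i (u i x)).
Proof.
move=> [h hP]; exists (fun i j => g j \o h i j) => i x /=.
by rewrite hP linearD /= cmap_diff.
Qed.

Lemma null_compr M N X (f : chain_map M N) (u : forall i, N i -> X i) :
  nullhomotopic u -> nullhomotopic (fun i x => u i (f i x)).
Proof.
move=> [h hP]; exists (fun i j => h i j \o f i) => i x /=.
by rewrite hP cmap_diff.
Qed.

(** The homotopy carries the same sign as the shifted differential, so the signs cancel in pairs. *)
Lemma null_shift M N (u : forall i, M i -> N i) n :
  nullhomotopic u ->
  nullhomotopic (M := shift M n) (N := shift N n) (fun i x => u (i + n) x).
Proof.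
move=> /nullP[h hP]; apply/nullP.
have slin i j : linear (fun x : shift M n i =>
    (-1) ^+ `|n|%N *: h (i + n) (j + n) x : shift N n j).
  by move=> b x y; rewrite linearP scalerDr !scalerA commr_sign.
exists (fun i j => mklin (slin i j)) => p i l x pi il.
rewrite (hP (p + n) (i + n) (l + n)); [|by rewrite addrAC pi|by rewrite addrAC il].
by rewrite /= /shift_diff !linearZ /= !scalerA -signr_odd -expr2 sqrr_sign !scale1r.
Qed.

(* Coordinates in a basis of the morphism space, so that its dimension is
   [hom_dim M N] on the nose. *)
Definition hom M N := 'rV[k]_(hom_dim M N).

Lemma hom_dimP M N :
  exists b : 'I_(hom_dim M N) -> chain_map M N, hom_basis b.
Proof. exact: (xgetPex 0%N (hom_basis_exists M N)). Qed.

Definition hbasis M N : 'I_(hom_dim M N) -> chain_map M N :=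
  projT1 (cid (hom_dimP M N)).

Lemma hbasisP M N : hom_basis (@hbasis M N).
Proof. exact: projT2 (cid (hom_dimP M N)). Qed.

Definition cl M N (f : chain_map M N) : hom M N :=
  projT1 (cid (@hbasisP M N f)).

Definition rep M N (f : hom M N) : chain_map M N := ccomb f (@hbasis M N).

Lemma cl_uniq M N (f : chain_map M N) c : homotopic f (rep c) -> cl f = c.
Proof. by move=> fc; case: (projT2 (cid (@hbasisP M N f))) => _; apply. Qed.

Lemma homotopic_refl M N (f : chain_map M N) : homotopic f f.
Proof. by apply: null_ext (null0 M N) => i x; rewrite subrr. Qed.

Lemma homotopic_sym M N (f g : chain_map M N) : homotopic f g -> homotopic g f.
Proof.
move=> fg; apply: (null_lin (a := -1)) fg (null0 M N) _ => i x.
by rewrite !scaleN1r opprB addr0.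
Qed.

Lemma homotopic_trans M N (f g h : chain_map M N) :
  homotopic f g -> homotopic g h -> homotopic f h.
Proof.
move=> fg gh; apply: (null_lin (a := 1)) fg gh _ => i x.
by rewrite !scale1r addrA subrK.
Qed.

Lemma rep_cl M N (f : chain_map M N) : homotopic f (rep (cl f)).
Proof. by have [] := projT2 (cid (@hbasisP M N f)). Qed.

Lemma cl_rep M N (f : hom M N) : cl (rep f) = f.
Proof. exact/cl_uniq/homotopic_refl. Qed.

Lemma clP M N (f g : chain_map M N) : homotopic f g <-> cl f = cl g.
Proof.
split=> [fg | fg]; first exact: cl_uniq (homotopic_trans fg (rep_cl g)).
apply: homotopic_trans (rep_cl f) _; rewrite fg.
exact/homotopic_sym/rep_cl.
Qed.

Lemma hom_ind M N (P : hom M N -> Prop) :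
  (forall f, P (cl f)) -> forall f, P f.
Proof. by move=> Pcl f; rewrite -[f]cl_rep. Qed.

Lemma cl_ext M N (f g : chain_map M N) : (forall i x, f i x = g i x) ->
  cl f = cl g.
Proof.
by move=> fg; apply/clP/(null_ext _ (null0 M N)) => i x; rewrite fg subrr.
Qed.

Lemma cl_clin M N a (f g : chain_map M N) : cl (clin a f g) = a *: cl f + cl g.
Proof.
apply: cl_uniq; apply: (null_lin (a := a)) (rep_cl f) (rep_cl g) _ => i x /=.
rewrite /clin_fun /lincomb scalerBr addrACA; congr (_ + _).
rewrite -opprD scaler_sumr -big_split; congr (- _); apply: eq_bigr => j _ /=.
by rewrite !mxE -scaleAM -scaleAD.
Qed.

Lemma cl_czero M N : cl (czero M N) = 0.
Proof.
have := cl_clin (-1) (czero M N) (czero M N).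
by rewrite scaleN1r addNr => <-; apply: cl_ext => i x; rewrite /= /clin_fun /= scaler0 addr0.
Qed.

Lemma cl0P M N (f : chain_map M N) : nullhomotopic (fun i => f i) <-> cl f = 0.
Proof.
rewrite -cl_czero -clP; split; apply: null_ext => i x; by rewrite /= subr0.
Qed.

Definition comp M N X (g : hom N X) (f : hom M N) : hom M X :=
  cl (ccomp (rep g) (rep f)).
Notation "g \oh f" := (comp g f).

Lemma compE M N X (g : chain_map N X) (f : chain_map M N) :
  cl g \oh cl f = cl (ccomp g f).
Proof.
apply/clP/homotopic_sym.
apply: (@homotopic_trans _ _ _ (ccomp g (rep (cl f)))).
  by apply: null_ext (null_compl g (rep_cl f)) => i x; rewrite /= linearB.
exact: null_compr (rep_cl g).
Qed.

Fact comp_linear M N X (g : hom N X) : linear (fun f : hom M N => g \oh f).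
Proof.
move=> a; elim/hom_ind=> f1; elim/hom_ind=> f2; elim/hom_ind: g => g.
rewrite -cl_clin !compE -cl_clin; apply: cl_ext => i x /=.
by rewrite /clin_fun linearP.
Qed.

(** A second name for composition, to carry the linear structure in the outer map; [comp g] carries
    the one in the inner map. *)
Definition precomp M N X (f : hom M N) (g : hom N X) := g \oh f.
Fact precomp_linear M N X (f : hom M N) : linear (@precomp M N X f).
Proof.
move=> a; elim/hom_ind=> g1; elim/hom_ind=> g2; elim/hom_ind: f => f.
by rewrite /precomp -cl_clin !compE -cl_clin; apply: cl_ext.
Qed.
HB.instance Definition _ M N X (g : hom N X) :=
  GRing.isLinear.Build k (hom M N) (hom M X) *:%R (comp g)
    (@comp_linear M N X g).
HB.instance Definition _ M N X (f : hom M N) :=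
  GRing.isLinear.Build k (hom N X) (hom M X) *:%R (precomp f)
    (@precomp_linear M N X f).

Lemma comp0h M N X (f : hom M N) : (0 : hom N X) \oh f = 0.
Proof. exact: (linear0 (@precomp M N X f)). Qed.
Lemma compDl M N X (f : hom M N) (g1 g2 : hom N X) :
  (g1 + g2) \oh f = g1 \oh f + g2 \oh f.
Proof. exact: (linearD (@precomp M N X f)). Qed.
Lemma compBl M N X (f : hom M N) (g1 g2 : hom N X) :
  (g1 - g2) \oh f = g1 \oh f - g2 \oh f.
Proof. exact: (linearB (@precomp M N X f)). Qed.
Lemma compZl M N X a (f : hom M N) (g : hom N X) :
  (a *: g) \oh f = a *: (g \oh f).
Proof. exact: (linearZ_LR (@precomp M N X f)). Qed.
Lemma comph0 M N X (g : hom N X) : g \oh (0 : hom M N) = 0.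
Proof. exact: linear0. Qed.
Lemma compDr M N X (f1 f2 : hom M N) (g : hom N X) :
  g \oh (f1 + f2) = g \oh f1 + g \oh f2.
Proof. exact: linearD. Qed.
Lemma compBr M N X (f1 f2 : hom M N) (g : hom N X) :
  g \oh (f1 - f2) = g \oh f1 - g \oh f2.
Proof. exact: linearB. Qed.
Lemma compZr M N X a (f : hom M N) (g : hom N X) :
  g \oh (a *: f) = a *: (g \oh f).
Proof. exact: linearZ_LR. Qed.

Definition hid M : hom M M := cl (Defs.cid M).

Lemma compA M N X Y (h : hom X Y) (g : hom N X) (f : hom M N) :
  h \oh (g \oh f) = h \oh g \oh f.
Proof.
elim/hom_ind: f => f; elim/hom_ind: g => g; elim/hom_ind: h => h.
by rewrite !compE; apply: cl_ext.
Qed.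
Lemma comp1h M N (f : hom M N) : hid N \oh f = f.
Proof. by elim/hom_ind: f => f; rewrite compE; apply: cl_ext. Qed.
Lemma comph1 M N (f : hom M N) : f \oh hid M = f.
Proof. by elim/hom_ind: f => f; rewrite compE; apply: cl_ext. Qed.

Definition sh n M N (f : hom M N) : hom (shift M n) (shift N n) :=
  cl (shift_map (rep f) n).

Lemma shE n M N (f : chain_map M N) : sh n (cl f) = cl (shift_map f n).
Proof. exact/clP/homotopic_sym/(null_shift n (rep_cl f)). Qed.

Fact sh_linear n M N : linear (@sh n M N).
Proof.
move=> a; elim/hom_ind=> f1; elim/hom_ind=> f2.
by rewrite -cl_clin !shE -cl_clin; apply: cl_ext.
Qed.
HB.instance Definition _ n M N :=
  GRing.isLinear.Build k (hom M N) (hom (shift M n) (shift N n)) *:%R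
    (@sh n M N) (@sh_linear n M N).

Lemma sh_comp n M N X (g : hom N X) (f : hom M N) :
  sh n (g \oh f) = sh n g \oh sh n f.
Proof.
elim/hom_ind: f => f; elim/hom_ind: g => g.
by rewrite compE !shE compE; apply: cl_ext.
Qed.

Lemma sh_id n M : sh n (hid M) = hid (shift M n).
Proof. by rewrite shE; apply: cl_ext. Qed.

Definition is_iso M N (f : hom M N) :=
  exists g : hom N M, g \oh f = hid M /\ f \oh g = hid N.

Lemma hequivP M N (f : chain_map M N) : hequiv f <-> is_iso (cl f).
Proof.
split=> [[g [/clP gf /clP fg]]|[]]; first by exists (cl g); rewrite !compE.
elim/hom_ind=> g; rewrite !compE => -[gf fg].
by exists g; split; apply/clP.
Qed.

Lemma hisoP M N : hiso M N <-> exists f : hom M N, is_iso f.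
Proof.
split=> [[f /hequivP fi]|[]]; first by exists (cl f).
by elim/hom_ind=> f fi; exists f; apply/hequivP.
Qed.

Lemma split_epiP M N (f : chain_map M N) :
  split_epi f <-> exists s, cl f \oh s = hid N.
Proof.
split=> [[s /clP fs]|[]]; first by exists (cl s); rewrite compE.
by elim/hom_ind=> s; rewrite compE => /clP; exists s.
Qed.

Lemma split_monoP M N (f : chain_map M N) :
  split_mono f <-> exists r, r \oh cl f = hid M.
Proof.
split=> [[s /clP fs]|[]]; first by exists (cl s); rewrite compE.
by elim/hom_ind=> s; rewrite compE => /clP; exists s.
Qed.

Lemma hzeroP M : hzero M <-> hid M = 0.
Proof. exact: cl0P. Qed.

Lemma iso_comp M N X (g : hom N X) (f : hom M N) :
  is_iso g -> is_iso f -> is_iso (g \oh f).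
Proof.
move=> [g' [gg gg']] [f' [ff ff']]; exists (f' \oh g'); split.
  by rewrite compA -(compA f') gg comph1.
by rewrite compA -(compA g) ff' comph1.
Qed.

Lemma iso_id M : is_iso (hid M).
Proof. by exists (hid M); rewrite comp1h. Qed.

Lemma iso_sh n M N (f : hom M N) : is_iso f -> is_iso (sh n f).
Proof. by move=> [g [gf fg]]; exists (sh n g); rewrite -!sh_comp gf fg !sh_id. Qed.

Lemma hiso_refl M : hiso M M.
Proof. by apply/hisoP; exists (hid M); apply: iso_id. Qed.

Lemma hiso_sym M N : hiso M N -> hiso N M.
Proof. by move=> /hisoP[f [g [gf fg]]]; apply/hisoP; exists g, f. Qed.

Lemma hiso_trans M N X : hiso M N -> hiso N X -> hiso M X.
Proof.
move=> /hisoP[f fi] /hisoP[g gi]; apply/hisoP.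
by exists (g \oh f); apply: iso_comp.
Qed.

Lemma hiso_shift n M N : hiso M N -> hiso (shift M n) (shift N n).
Proof.
by move=> /hisoP[f fi]; apply/hisoP; exists (sh n f); apply: iso_sh.
Qed.

(** * Isomorphisms between iterated shifts *)

Lemma along_diff M i i' j j' x : i = i' -> j = j' ->
  along j' (diff M i j x) = diff M i' j' (along i' x).
Proof. by move=> <- <-; rewrite !along_id. Qed.

Lemma along_along M i j l (x : M i) : i = j -> along l (along j x) = along l x.
Proof. by move=> <-; rewrite along_id. Qed.

(** The exponent in the sign of a shift is an absolute value, which is not additive; as integer
    powers the signs multiply correctly. *)
Lemma sign_absz (R : unitRingType) (a : int) : (-1) ^+ `|a|%N = (-1) ^ a :> R.
Proof. by case: a => n //; rewrite /exprz /= invr_sign. Qed.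

Lemma sign_abszD (R : unitRingType) (a b : int) :
  (-1) ^+ `|b|%N * (-1) ^+ `|a|%N = (-1) ^+ `|(a + b)%R|%N :> R.
Proof. by rewrite !sign_absz -exprzDr ?unitrN1 // addrC. Qed.

Lemma addr_shift (a b c i : int) : a + b = c -> i + b + a = i + c.
Proof. by move=> <-; rewrite addrAC addrA. Qed.

Fact shift_add_diff (a b c : int) (abc : a + b = c) M (i j : int) (x : M (i + b + a)) :
  @along _ _ M (j + b + a) (j + c) (diff (shift (shift M a) b) i j x) =
  diff (shift M c) i j (along (i + c) x).
Proof.
rewrite /= /shift_diff /= /shift_diff !linearZ /= scalerA sign_abszD abc.
by congr (_ *: _); apply: along_diff; apply: addr_shift.
Qed.

Fact shift_sub_diff (a b c : int) (abc : a + b = c) M (i j : int) (x : M (i + c)) :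
  @along _ _ M (j + c) (j + b + a) (diff (shift M c) i j x) =
  diff (shift (shift M a) b) i j (along (i + b + a) x).
Proof.
rewrite /= /shift_diff /= /shift_diff !linearZ /= scalerA sign_abszD abc.
by congr (_ *: _); apply: along_diff; rewrite (addr_shift _ abc).
Qed.

(** The sum enters through an equation so that [c] may be any form of a + b; with c = 0 it leads to
    [unsh]. *)
Definition shift_add (a b c : int) (abc : a + b = c) M :
    chain_map (shift (shift M a) b) (shift M c) :=
  @ChainMap _ _ (shift (shift M a) b) (shift M c)
    (fun i => @along _ _ M (i + b + a) (i + c) :
       {linear M (i + b + a) -> M (i + c)}) (@shift_add_diff a b c abc M).

Definition shift_sub (a b c : int) (abc : a + b = c) M :
    chain_map (shift M c) (shift (shift M a) b) :=
  @ChainMap _ _ (shift M c) (shift (shift M a) b)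
    (fun i => @along _ _ M (i + c) (i + b + a) :
       {linear M (i + c) -> M (i + b + a)}) (@shift_sub_diff a b c abc M).

Lemma shift_add_iso (a b c : int) (abc : a + b = c) M : is_iso (cl (shift_add abc M)).
Proof.
exists (cl (shift_sub abc M)); rewrite !compE.
by split; apply: cl_ext => i x; rewrite /= along_along ?along_id //; rewrite (addr_shift _ abc).
Qed.

Lemma shift_add_natural (a b c : int) (abc : a + b = c) M N (f : hom M N) :
  cl (shift_add abc N) \oh sh b (sh a f) = sh c f \oh cl (shift_add abc M).
Proof.
elim/hom_ind: f => f; rewrite !shE !compE; apply: cl_ext => i x /=.
by move: x; rewrite /= (addr_shift i abc) => x; rewrite !along_id.
Qed.

Program Definition shift0 M : chain_map (shift M 0) M :=
  @ChainMap _ _ (shift M 0) M (fun i => @along _ _ M (i + 0) i : {linear M (i + 0) -> M i}) _.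
Next Obligation.
by rewrite /= /shift_diff /= expr0 scale1r; apply: along_diff; rewrite addr0.
Qed.

Program Definition unshift0 M : chain_map M (shift M 0) :=
  @ChainMap _ _ M (shift M 0) (fun i => @along _ _ M i (i + 0) : {linear M i -> M (i + 0)}) _.
Next Obligation.
by rewrite /= /shift_diff /= expr0 scale1r; apply: along_diff; rewrite addr0.
Qed.

Lemma shift0_iso M : is_iso (cl (shift0 M)).
Proof.
exists (cl (unshift0 M)); rewrite !compE.
by split; apply: cl_ext => i x; rewrite /= along_along ?along_id ?addr0.
Qed.

Lemma shift0_natural M N (f : hom M N) :
  cl (shift0 N) \oh sh 0 f = f \oh cl (shift0 M).
Proof.
elim/hom_ind: f => f; rewrite !shE !compE; apply: cl_ext => i x /=.
have e : i + 0 = i := addr0 i; move: x; rewrite /=.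
by case: _ / (esym e) => x; rewrite !along_id.
Qed.

Definition unsh n M : hom (shift (shift M n) (- n)) M :=
  cl (shift0 M) \oh cl (shift_add (subrr n) M).

Lemma unsh_iso n M : is_iso (unsh n M).
Proof. by apply: iso_comp; [apply: shift0_iso | apply: shift_add_iso]. Qed.

Lemma unsh_natural n M N (f : hom M N) :
  unsh n N \oh sh (- n) (sh n f) = f \oh unsh n M.
Proof. by rewrite -compA shift_add_natural compA shift0_natural -compA. Qed.

Lemma hiso_shift_add M a b : hiso (shift (shift M a) b) (shift M (a + b)).
Proof. by apply/hisoP; eexists; apply: (shift_add_iso (erefl _)). Qed.

Lemma hiso_shift0 M : hiso (shift M 0) M.
Proof. by apply/hisoP; eexists; apply: shift0_iso. Qed.

(** [unsh] is a natural isomorphism from the shift by n followed by the shift by -n to the identity,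
    so [f] is recovered from its shift by conjugation. *)
Lemma sh_inj n M N : injective (@sh n M N).
Proof.
have [e [_ ee]] := unsh_iso n M; apply: (can_inj (g := fun f => unsh n N \oh sh (- n) f \oh e)) => f.
by rewrite unsh_natural -compA ee comph1.
Qed.

(** * Dimensions of morphism spaces under isomorphism and shift *)

Lemma leq_dim m n (F : {linear 'rV[k]_m -> 'rV[k]_n}) :
  injective F -> (m <= n)%N.
Proof.
move=> Fi; suff /eqP <- : row_free (lin1_mx F) by apply: rank_leq_col.
apply: inj_row_free => v; rewrite mul_rV_lin1 => Fv.
by apply: Fi; rewrite Fv linear0.
Qed.

Lemma hom_dim_isol M M' N : hiso M M' -> hom_dim M N = hom_dim M' N.
Proof.
move=> /hisoP[f [g [gf fg]]]; apply/eqP; rewrite eqn_leq; apply/andP; split.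
  apply: (leq_dim (F := @precomp M' M N g)).
  by apply: (can_inj (g := @precomp M M' N f)) => u; rewrite /precomp -compA gf comph1.
apply: (leq_dim (F := @precomp M M' N f)).
by apply: (can_inj (g := @precomp M' M N g)) => u; rewrite /precomp -compA fg comph1.
Qed.

Lemma hom_dim_isor M N N' : hiso N N' -> hom_dim M N = hom_dim M N'.
Proof.
move=> /hisoP[f [g [gf fg]]]; apply/eqP; rewrite eqn_leq; apply/andP; split.
  apply: (leq_dim (F := @comp M N N' f)).
  by apply: (can_inj (g := @comp M N' N g)) => u; rewrite compA gf comp1h.
apply: (leq_dim (F := @comp M N' N g)).
by apply: (can_inj (g := @comp M N N' f)) => u; rewrite compA fg comp1h.
Qed.

Lemma hiso_unsh n M : hiso (shift (shift M n) (- n)) M.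
Proof. by apply/hisoP; exists (unsh n M); apply: unsh_iso. Qed.

(** Shifting by n and by -n are both injective on morphisms, which gives the two inequalities. *)
Lemma hom_dim_sh n M N : hom_dim (shift M n) (shift N n) = hom_dim M N.
Proof.
apply/eqP; rewrite eqn_leq; apply/andP; split; last exact: leq_dim (@sh_inj n M N).
apply: leq_trans (leq_dim (@sh_inj (- n) _ _)) _.
by rewrite (hom_dim_isol _ (hiso_unsh n M)) (hom_dim_isor _ (hiso_unsh n N)).
Qed.

Lemma hom_dim_shift W V a b :
  hom_dim (shift W a) (shift V b) = hom_dim W (shift V (b - a)).
Proof.
rewrite -(hom_dim_sh (- a)) (hom_dim_isol _ (hiso_unsh a W)).
exact/hom_dim_isor/hiso_shift_add.
Qed.

End Hom.
Notation "g \oh f" := (comp g f).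

(** * Exactness of the cone sequences *)

Section Cone.
Variables (k : fieldType) (A : falgType k).
Implicit Types (M N X Y Z W V : perf A).

(** Off consecutive degrees both differentials vanish, so commutation is only to be checked from i
    to i + 1. *)
Lemma chain_map_from M N (f : forall i, {linear M i -> N i}) :
  (forall i x, f (i + 1) (diff M i (i + 1) x) = diff N i (i + 1) (f i x)) ->
  exists g : chain_map M N, forall i x, g i x = f i x.
Proof.
move=> fd; suff fc i j x : f j (diff M i j x) = diff N i j (f i x).
  by exists (ChainMap fc).
have [-> //|ij] := eqVneq j (i + 1).
by rewrite !diff_shape // linear0.
Qed.

Lemma along_map M N (f : chain_map M N) i j (x : M i) :
  i = j -> along j (f i x) = f j (along j x).
Proof. by move=> <-; rewrite !along_id. Qed.

Lemma diff_along M i i' j (x : M i) : i = i' ->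
  diff M i' j (along i' x) = diff M i j x.
Proof. by move=> <-; rewrite along_id. Qed.

Lemma along_diff_r M i j j' (x : M i) : j = j' ->
  along j' (diff M i j x) = diff M i j' x.
Proof. by move=> <-; rewrite along_id. Qed.

Section ConeOf.
Variables (X Y : perf A) (f : chain_map X Y).

(** A nullhomotopy of the composite takes values in the sum of X[1] and Y. Its first component
    commutes with the differentials and is the chain map [u]; its second is a homotopy from [g] to
    [f u]. *)
Lemma cone_exact_cod W (g : hom W Y) :
  cl (cone_in f) \oh g = 0 -> exists u, g = cl f \oh u.
Proof.
elim/hom_ind: g => g; rewrite compE => /cl0P /nullP[h hP].
have h1 (p i n : int) x (pi : p + 1 = i) (iN : i + 1 = n) :
    diff X (p + 1) (i + 1) (h i p x).1 = (h n i (diff W i n x)).1.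
  have /(congr1 fst) /= := hP p i n x pi iN.
  rewrite /inclR /= /shift_diff expr1 scaleN1r => /esym/eqP.
  by rewrite addr_eq0 eqr_opp => /eqP.
have h2 (p i n : int) x (pi : p + 1 = i) (iN : i + 1 = n) :
    g i x = along i (f (p + 1) (h i p x).1) + diff Y p i (h i p x).2 +
            (h n i (diff W i n x)).2.
  by have /(congr1 snd) /= := hP p i n x pi iN.
have ulin i : linear (fun x => @along _ _ X (i - 1 + 1) i (h i (i - 1) x).1).
  by move=> a x y; rewrite !linearP.
have uE (i p : int) x : p + 1 = i -> mklin (ulin i) x = @along _ _ X (p + 1) i (h i p x).1.
  by move=> pi; have -> : p = i - 1 by rewrite -pi addrK.
have [u uP] : exists u : chain_map W X, forall i x, u i x = mklin (ulin i) x.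
  apply: chain_map_from => i x; rewrite (uE _ i) // along_id.
  rewrite (uE _ (i - 1)) ?subrK // diff_along ?subrK //.
  by rewrite (h1 _ _ (i + 1)) ?subrK.
exists (cl u); rewrite compE; apply/clP/nullP.
exists (fun i j => mklin (f := fun x => (h i j x).2) (fun a x y => f_equal snd (linearP (h i j) a x y))).
move=> p i n x pi iN; rewrite /= uP (uE _ p) // (h2 p i n) //.
by rewrite along_map // addrAC [X in X + _]addrAC subrr add0r.
Qed.

(** With [s] a nullhomotopy of the first component of [g], subtracting the boundary of (s, 0)
    removes that component and leaves [g.2 - f s], a map into Y. *)
Lemma cone_exact_cone W (g : hom W (cone f)) :
  cl (cone_out f) \oh g = 0 -> exists u, g = cl (cone_in f) \oh u.
Proof.
elim/hom_ind: g => g; rewrite compE => /cl0P /nullP[s sP].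
have sE (p i n : int) x (pi : p + 1 = i) (iN : i + 1 = n) :
    (g i x).1 = - diff X (p + 1) (i + 1) (s i p x) + s n i (diff W i n x).
  by have := sP p i n x pi iN; rewrite /= /shift_diff expr1 scaleN1r.
have ulin i : linear (fun x => (g i x).2 - along i (f (i - 1 + 1) (s i (i - 1) x))).
  move=> a x y; rewrite !linearP /=.
  by rewrite addrACA -scalerDr.
have uE (i p : int) x : p + 1 = i ->
    mklin (ulin i) x = (g i x).2 - along i (f (p + 1) (s i p x)).
  by move=> pi; have -> : p = i - 1 by rewrite -pi addrK.
have [u uP] : exists u : chain_map W Y, forall i x, u i x = mklin (ulin i) x.
  apply: chain_map_from => i x; rewrite (uE _ i) // along_id.
  rewrite (uE _ (i - 1)) ?subrK // linearB /=.
  have /(congr1 snd) /= -> := cmap_diff g (i + 1) x.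
  rewrite along_id (sE (i - 1) i (i + 1)) ?subrK // linearD linearN /=.
  rewrite cmap_diff diff_along ?subrK //.
  by rewrite addrAC addrK addrC.
exists (cl u); rewrite compE; apply/clP/nullP.
have Slin i j : linear (fun x => (s i j x, 0) : cone f j).
  by move=> a x y; rewrite !linearP; congr pair; rewrite /= scaler0 addr0.
exists (fun i j => mklin (Slin i j)) => p i n x pi iN.
apply: injective_projections; rewrite /= /inclR /=.
  by rewrite subr0 (sE p i n) // /shift_diff expr1 scaleN1r.
by rewrite uP (uE _ p) // linear0 !addr0 opprB addrC subrK.
Qed.

(** The nullhomotopy [s] of f[1] g is exactly the second component that makes (g, s) a chain map
    into the cone. *)
Lemma cone_exact_shift W (g : hom W (shift X 1)) :
  sh 1 (cl f) \oh g = 0 -> exists u, g = cl (cone_out f) \oh u.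
Proof.
elim/hom_ind: g => g; rewrite shE compE => /cl0P /nullP[s sP].
have sE (p i n : int) x (pi : p + 1 = i) (iN : i + 1 = n) :
    f (i + 1) (g i x) = - diff Y (p + 1) (i + 1) (s i p x) + s n i (diff W i n x).
  by have := sP p i n x pi iN; rewrite /= /shift_diff expr1 scaleN1r.
have ulin i : linear (fun x => (g i x, @along _ _ Y (i - 1 + 1) i (s i (i - 1) x)) : cone f i).
  by move=> a x y; rewrite !linearP.
have uE (i p : int) x : p + 1 = i -> mklin (ulin i) x = (g i x, @along _ _ Y (p + 1) i (s i p x)).
  by move=> pi; have -> : p = i - 1 by rewrite -pi addrK.
have [u uP] : exists u : chain_map W (cone f),
    forall i x, u i x = mklin (ulin i) x.
  apply: chain_map_from => i x; rewrite (uE _ i) // along_id.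
  rewrite (uE _ (i - 1)) ?subrK //; apply: injective_projections => /=.
    by rewrite cmap_diff.
  rewrite along_id (sE (i - 1) i (i + 1)) ?subrK // diff_along ?subrK //.
  by rewrite addrAC addNr add0r.
exists (cl u); rewrite compE; apply: cl_ext => i x /=.
by rewrite uP.
Qed.

Lemma cone_in_comp : cl (cone_in f) \oh cl f = 0.
Proof.
rewrite compE; apply/cl0P/nullP.
(* The homotopy is the inclusion of [X] into the cone, lowering the degree by one. *)
have slin i j : linear (fun x : X i => (@along _ _ X i (j + 1) x, 0) : cone f j).
  by move=> a x y; rewrite !linearP; congr pair; rewrite /= scaler0 addr0.
exists (fun i j => mklin (slin i j)) => p i n x pi iN.
apply: injective_projections; rewrite /= /inclR /=.
  by rewrite /shift_diff expr1 scaleN1r diff_along // along_diff_r // addNr.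
by rewrite linear0 !addr0 along_map // along_along // along_id.
Qed.

Lemma cone_out_comp : cl (cone_out f) \oh cl (cone_in f) = 0.
Proof. by rewrite compE; apply/cl0P/(null_ext _ (null0 _ _)). Qed.

Lemma cone_shift_comp : sh 1 (cl f) \oh cl (cone_out f) = 0.
Proof.
rewrite shE compE; apply/cl0P/nullP.
have slin i j : linear (fun z : cone f i => @along _ _ Y i (j + 1) z.2 : shift Y 1 j).
  by move=> a x y; rewrite linearP.
exists (fun i j => mklin (slin i j)) => p i n x pi iN /=.
rewrite /shift_diff expr1 scaleN1r diff_along //.
rewrite linearD /= along_along // along_id along_diff_r //.
by rewrite addrCA addNr addr0.
Qed.

(** The nullhomotopy [s] of [g f] extends [g] over the summand X[1]: the map is g y + s x. *)
Lemma cone_coexact_cod V (g : hom Y V) :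
  g \oh cl f = 0 -> exists u, g = u \oh cl (cone_in f).
Proof.
elim/hom_ind: g => g; rewrite compE => /cl0P /nullP[s sP].
have sE (p i n : int) x (pi : p + 1 = i) (iN : i + 1 = n) :
    g i (f i x) = diff V p i (s i p x) + s n i (diff X i n x) := sP p i n x pi iN.
have ulin i : linear (fun z : cone f i => g i z.2 + s (i + 1) i z.1).
  by move=> a x y; rewrite /= !linearP /= scalerDr addrACA.
have [u uP] : exists u : chain_map (cone f) V,
    forall i x, u i x = mklin (ulin i) x.
  apply: chain_map_from => i [x y] /=.
  rewrite along_id !linearD /= -!cmap_diff (sE i (i + 1) (i + 1 + 1)) //=.
  by rewrite /shift_diff expr1 scaleN1r linearN /= addrAC addrK addrC.
exists (cl u); rewrite compE; apply: cl_ext => i x /=.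
by rewrite uP /= /inclR /= linear0 addr0.
Qed.

(** [s] contracts [g] on the summand Y, and g(x, 0) - s(f x) is the induced map on X[1]. *)
Lemma cone_coexact_cone V (g : hom (cone f) V) :
  g \oh cl (cone_in f) = 0 -> exists u, g = u \oh cl (cone_out f).
Proof.
elim/hom_ind: g => g; rewrite compE => /cl0P /nullP[s sP].
have sE (p i n : int) y (pi : p + 1 = i) (iN : i + 1 = n) :
    g i (0, y) = diff V p i (s i p y) + s n i (diff Y i n y) := sP p i n y pi iN.
have gE i x y : g i (x, y) = g i (x, 0) + g i (0, y).
  rewrite -linearD; congr (g i _); apply: injective_projections => /=.
    by rewrite addr0.
  by rewrite add0r.
have gd i x : g (i + 1) (diff (shift X 1) i (i + 1) x, 0) +
    g (i + 1) (0, f (i + 1) x) = diff V i (i + 1) (g i (x, 0)).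
  rewrite -cmap_diff -gE; congr (g _ _); apply: injective_projections => //=.
  by rewrite along_id linear0 addr0.
have ulin i : linear (fun x : shift X 1 i => g i (x, 0) - s (i + 1) i (f (i + 1) x)).
  move=> a x y.
  have -> : (a *: x + y, 0) = a *: (x, 0) + (y, 0) :> cone f i.
    by congr pair; rewrite /= scaler0 addr0.
  by rewrite !linearP /= addrACA -scalerDr.
have [u uP] : exists u : chain_map (shift X 1) V,
    forall i x, u i x = mklin (ulin i) x.
  apply: chain_map_from => i x /=.
  rewrite [in RHS]linearB /= -gd.
  rewrite (sE i (i + 1) (i + 1 + 1)) //= /shift_diff expr1 scaleN1r !linearN /=.
  by rewrite cmap_diff opprK -[RHS]addrA; congr (_ + _); rewrite [RHS]addrAC subrr add0r.
exists (cl u); rewrite compE; apply/clP/nullP.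
exists (fun i j => mklin (f := fun z : cone f i => s i j z.2)
  (fun a x y => linearP (s i j) a x.2 y.2)) => p i n [x y] pi iN /=.
subst n; rewrite uP gE (sE p i (i + 1)) //= opprB addrC subrKA.
by rewrite along_id linearD addrCA.
Qed.

(** The nullhomotopy has two restrictions: on Y it is the map [u], on X[1] it is, up to sign, a
    homotopy from [g] to [u f]. *)
Lemma cone_coexact_shift V (g : hom X V) :
  sh 1 g \oh cl (cone_out f) = 0 -> exists u, g = u \oh cl f.
Proof.
elim/hom_ind: g => g; rewrite shE compE => /cl0P /nullP[s sP].
have sE (q p n : int) x y (qp : q + 1 = p) (pn : p + 1 = n) :
    g (p + 1) x = - diff V (q + 1) (p + 1) (s p q (x, y)) +
      s n p (- diff X (p + 1) (n + 1) x, along n (f (p + 1) x) + diff Y p n y).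
  have := sP q p n (x, y) qp pn.
  by rewrite /= /cone_diff /= /shift_diff expr1 !scaleN1r.
have inl (i : int) a (x y : X (i + 1)) :
    (a *: x + y, 0) = a *: (x, 0) + (y, 0) :> cone f i.
  by congr pair; rewrite /= scaler0 addr0.
have inr (i : int) a (x y : Y i) :
    (0, a *: x + y) = a *: (0, x) + (0, y) :> cone f i.
  by congr pair; rewrite /= scaler0 addr0.
have ulin i : linear (fun y => @along _ _ V (i - 1 + 1) i (s i (i - 1) (0, y))).
  by move=> a x y; rewrite inr !linearP.
have uE (i p : int) y : p + 1 = i ->
    mklin (ulin i) y = @along _ _ V (p + 1) i (s i p (0, y)).
  by move=> pi; have -> : p = i - 1 by rewrite -pi addrK.
have [u uP] : exists u : chain_map Y V, forall i x, u i x = mklin (ulin i) x.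
  apply: chain_map_from => i y; rewrite (uE _ i) // along_id.
  rewrite (uE _ (i - 1)) ?subrK // diff_along ?subrK //.
  have := sE (i - 1) i (i + 1) 0 y (subrK 1 i) erefl.
  rewrite !linear0 add0r ?oppr0 => /esym/eqP.
  by rewrite addr_eq0 eqr_opp eq_sym => /eqP.
exists (cl u); rewrite compE; apply/clP/nullP.
have Hlin i j : linear (fun x => - @along _ _ V (j - 1 + 1) j
    (s (i - 1) (j - 1) (@along _ _ X i (i - 1 + 1) x, 0))).
  by move=> a x y; rewrite linearP inl !linearP.
have HE (i j p q : int) x : p + 1 = i -> q + 1 = j -> mklin (Hlin i j) x =
    - @along _ _ V (q + 1) j (s p q (@along _ _ X i (p + 1) x, 0)).
  move=> pi qj; have -> : p = i - 1 by rewrite -pi addrK.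
  by have -> : q = j - 1 by rewrite -qj addrK.
exists (fun i j => mklin (Hlin i j)) => p i n x pi iN.
rewrite (HE i p p (p - 1)) ?subrK // (HE n i i p) // /= uP (uE i p) //.
subst n; subst i; rewrite !along_id linearN /= diff_along ?subrK //.
rewrite (sE (p - 1) p (p + 1) x 0) ?subrK // linear0 addr0 along_id.
rewrite -addrA; congr (_ + _).
have -> : (- diff X (p + 1) (p + 1 + 1) x, f (p + 1) x) =
    - (diff X (p + 1) (p + 1 + 1) x, 0) + (0, f (p + 1) x) :> cone f (p + 1).
  apply: injective_projections => /=; first by rewrite addr0.
  by rewrite oppr0 add0r.
by rewrite linearD linearN addrK.
Qed.

End ConeOf.
End Cone.

(** * Triangles, direct sums and dimension counts *)

Section Triangles.
Variables (k : fieldType) (A : falgType k).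
Implicit Types (M N X Y Z W V S : perf A).

(** What is retained of a distinguished triangle: consecutive composites vanish, and both Hom
    functors are exact at the three places. Exactness at X is phrased through X[1], where [w]
    lands. *)
Record exact_triangle X Y Z (u : hom X Y) (v : hom Y Z)
    (w : hom Z (shift X 1)) : Prop := ExactTriangle {
  tri_vu : v \oh u = 0;
  tri_wv : w \oh v = 0;
  tri_uw : sh 1 u \oh w = 0;
  tri_exact_v : forall W (g : hom W Y),
    v \oh g = 0 -> exists h, g = u \oh h;
  tri_exact_w : forall W (g : hom W Z),
    w \oh g = 0 -> exists h, g = v \oh h;
  tri_exact_u : forall W (g : hom W (shift X 1)),
    sh 1 u \oh g = 0 -> exists h, g = w \oh h;
  tri_coexact_u : forall V (g : hom Y V),
    g \oh u = 0 -> exists h, g = h \oh v;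
  tri_coexact_v : forall V (g : hom Z V),
    g \oh v = 0 -> exists h, g = h \oh w;
  tri_coexact_w : forall V (g : hom X V),
    sh 1 g \oh w = 0 -> exists h, g = h \oh u }.

Lemma cone_exact X Y (f : chain_map X Y) :
  exact_triangle (cl f) (cl (cone_in f)) (cl (cone_out f)).
Proof.
split.
- exact: cone_in_comp.
- exact: cone_out_comp.
- exact: cone_shift_comp.
- exact: cone_exact_cod.
- exact: cone_exact_cone.
- exact: cone_exact_shift.
- exact: cone_coexact_cod.
- exact: cone_coexact_cone.
- exact: cone_coexact_shift.
Qed.

(** Each morphism is carried to the cone triangle by the isomorphisms [a], [b], [c], a[1] or their
    inverses, factored there and carried back. *)
Lemma distinguished_exact X Y Z (u : chain_map X Y) (v : chain_map Y Z)
    (w : chain_map Z (shift X 1)) :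
  distinguished u v w -> exact_triangle (cl u) (cl v) (cl w).
Proof.
case=> X' [Y' [f [a [b [c [[/hequivP ai /hequivP bi /hequivP ci]]]]]]].
case=> /clP + /clP + /clP; rewrite -!compE -shE.
have [] := cone_exact f.
move: (cl u) (cl v) (cl w) (cl f) (cl (cone_in f)) (cl (cone_out f)) ai bi ci.
move: (cl a) (cl b) (cl c) => {u v w}a {}b {}c u v w u' v' w'.
move=> [a' [a'a aa']] [b' [b'b bb']] [c' [c'c cc']].
have s1 : sh 1 a' \oh sh 1 a = hid _ by rewrite -sh_comp a'a sh_id.
have s2 : sh 1 a \oh sh 1 a' = hid _ by rewrite -sh_comp aa' sh_id.
move=> vu wv uw ev ew eu cu cv cw bu cvb aw.
have uE : u = b' \oh u' \oh a by rewrite -compA -bu compA b'b comp1h.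
have vE : v = c' \oh v' \oh b by rewrite -compA -cvb compA c'c comp1h.
have wE : w = sh 1 a' \oh w' \oh c by rewrite -compA -aw compA s1 comp1h.
have u'E : u' = b \oh u \oh a' by rewrite bu -compA aa' comph1.
have v'E : v' = c \oh v \oh b' by rewrite cvb -compA bb' comph1.
have w'E : w' = sh 1 a \oh w \oh c' by rewrite aw -compA cc' comph1.
split.
- by rewrite vE -compA bu (compA _ u') -(compA c' v') vu comph0 comp0h.
- by rewrite wE -compA cvb (compA _ v') -(compA _ w') wv comph0 comp0h.
- by rewrite uE !sh_comp -compA aw (compA _ w') -(compA _ (sh 1 u')) uw comph0 comp0h.
- move=> W g vg; have [|h hE] := ev _ (b \oh g).
    by rewrite compA -cvb -compA vg comph0.
  exists (a' \oh h); rewrite compA uE -(compA (b' \oh u')) aa' comph1.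
  by rewrite -compA -hE compA b'b comp1h.
- move=> W g wg; have [|h hE] := ew _ (c \oh g).
    by rewrite compA -aw -compA wg comph0.
  exists (b' \oh h); rewrite compA vE -(compA (c' \oh v')) bb' comph1.
  by rewrite -compA -hE compA c'c comp1h.
- move=> W g ug; have [|h hE] := eu _ (sh 1 a \oh g).
    by rewrite compA -sh_comp -bu sh_comp -compA ug comph0.
  exists (c' \oh h); rewrite compA wE -(compA (_ \oh w')) cc' comph1.
  by rewrite -compA -hE compA s1 comp1h.
- move=> V g gu; have [|h hE] := cu _ (g \oh b').
    by rewrite -compA u'E !(compA b') b'b comp1h compA gu comp0h.
  exists (h \oh c); rewrite -compA cvb compA -hE -compA b'b comph1 //.
- move=> V g gv; have [|h hE] := cv _ (g \oh c').
    by rewrite -compA v'E !(compA c') c'c comp1h compA gv comp0h.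
  by exists (h \oh sh 1 a); rewrite -compA aw compA -hE -compA c'c comph1.
- move=> V g gw; have [|h hE] := cw _ (g \oh a').
    by rewrite sh_comp -compA w'E !(compA (sh 1 a')) s1 comp1h compA gw comp0h.
  by exists (h \oh b); rewrite -compA bu compA -hE -compA a'a comph1.
Qed.

(** An equational form of the direct sum in the homotopy category, stable under isomorphism and
    shift. *)
Definition biproduct S M N : Prop :=
  exists (i1 : hom M S) (i2 : hom N S) (p1 : hom S M) (p2 : hom S N),
    [/\ p1 \oh i1 = hid M, p2 \oh i2 = hid N, p1 \oh i2 = 0, p2 \oh i1 = 0 &
        i1 \oh p1 + i2 \oh p2 = hid S].

Program Definition dsum_inl M N : chain_map M (dsum M N) :=
  @ChainMap _ _ M (dsum M N) (fun i => @inclL A (M i) (N i)) _.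
Next Obligation. by rewrite /= /dsum_diff /inclL /= linear0. Qed.
Program Definition dsum_inr M N : chain_map N (dsum M N) :=
  @ChainMap _ _ N (dsum M N) (fun i => @inclR A (M i) (N i)) _.
Next Obligation. by rewrite /= /dsum_diff /inclR /= linear0. Qed.
Program Definition dsum_fst M N : chain_map (dsum M N) M :=
  @ChainMap _ _ (dsum M N) M (fun i => fst) _.
Program Definition dsum_snd M N : chain_map (dsum M N) N :=
  @ChainMap _ _ (dsum M N) N (fun i => snd) _.

Lemma dsum_biproduct M N : biproduct (dsum M N) M N.
Proof.
exists (cl (dsum_inl M N)), (cl (dsum_inr M N)), (cl (dsum_fst M N)),
  (cl (dsum_snd M N)).
rewrite !compE; split; try exact: cl_ext.
- by rewrite -cl_czero; apply: cl_ext.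
- by rewrite -cl_czero; apply: cl_ext.
rewrite -[X in X + _]scale1r -cl_clin; apply: cl_ext => i [x y].
by apply: injective_projections; rewrite /= !scale1r ?addr0 ?add0r.
Qed.

Lemma biproduct_hiso S S' M N : biproduct S M N -> biproduct S' M N -> hiso S S'.
Proof.
move=> [i1 [i2 [p1 [p2 [p1i1 p2i2 p1i2 p2i1 ip]]]]].
move=> [j1 [j2 [q1 [q2 [q1j1 q2j2 q1j2 q2j1 jq]]]]].
apply/hisoP; exists (j1 \oh p1 + j2 \oh p2), (i1 \oh q1 + i2 \oh q2); split.
  rewrite compDr !compDl !compA -(compA i1 q1 j1) -(compA i2 q2 j1).
  rewrite -(compA i1 q1 j2) -(compA i2 q2 j2) q1j1 q2j2 q1j2 q2j1.
  by rewrite !comph0 !comp0h !comph1 addr0 add0r.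
rewrite compDr !compDl !compA -(compA j1 p1 i1) -(compA j2 p2 i1).
rewrite -(compA j1 p1 i2) -(compA j2 p2 i2) p1i1 p2i2 p1i2 p2i1.
by rewrite !comph0 !comp0h !comph1 addr0 add0r.
Qed.

Lemma leq_dim_lin m n (F : 'rV[k]_m -> 'rV[k]_n) :
  linear F -> injective F -> (m <= n)%N.
Proof.
by move=> Fl; apply: (leq_dim (F := mklin Fl)).
Qed.

Lemma hom_dim_biproductr S M N W : biproduct S M N ->
  hom_dim W S = (hom_dim W M + hom_dim W N)%N.
Proof.
move=> [i1 [i2 [p1 [p2 [p1i1 p2i2 p1i2 p2i1 ip]]]]].
apply/eqP; rewrite eqn_leq; apply/andP; split.
  apply: (leq_dim_lin (F := fun f : hom W S => row_mx (p1 \oh f) (p2 \oh f))).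
    by move=> a f g; rewrite !linearP scale_row_mx add_row_mx.
  move=> f g /eq_row_mx [e1 e2].
  by rewrite -[f]comp1h -[g]comp1h -ip !compDl -!compA e1 e2.
apply: (leq_dim_lin (F := fun f : 'rV_(hom_dim W M + hom_dim W N) =>
  i1 \oh (lsubmx f : hom W M) + i2 \oh (rsubmx f : hom W N))).
  by move=> a f g; rewrite !linearP /= scalerDr addrACA.
move=> f g fg; rewrite -[f]hsubmxK -[g]hsubmxK; congr row_mx.
  move/(congr1 (comp p1)): fg; rewrite !compDr !compA p1i1 p1i2.
  by rewrite !comp1h !comp0h !addr0.
move/(congr1 (comp p2)): fg; rewrite !compDr !compA p2i1 p2i2.
by rewrite !comp1h !comp0h !add0r.
Qed.

Lemma hom_dim_biproductl S M N W : biproduct S M N ->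
  hom_dim S W = (hom_dim M W + hom_dim N W)%N.
Proof.
move=> [i1 [i2 [p1 [p2 [p1i1 p2i2 p1i2 p2i1 ip]]]]].
apply/eqP; rewrite eqn_leq; apply/andP; split.
  apply: (leq_dim_lin (F := fun f : hom S W => row_mx (f \oh i1) (f \oh i2))).
    move=> a f g; rewrite -![comp _ i1]/(precomp i1 _) -![comp _ i2]/(precomp i2 _).
    by rewrite !linearP scale_row_mx add_row_mx.
  move=> f g /eq_row_mx [e1 e2].
  by rewrite -[f]comph1 -[g]comph1 -ip !compDr !compA e1 e2.
apply: (leq_dim_lin (F := fun f : 'rV_(hom_dim M W + hom_dim N W) =>
  precomp p1 (lsubmx f : hom M W) + precomp p2 (rsubmx f : hom N W))).
  by move=> a f g; rewrite !linearP /= scalerDr addrACA.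
rewrite /precomp => f g fg; rewrite -[f]hsubmxK -[g]hsubmxK; congr row_mx.
  move/(congr1 (precomp i1)): fg; rewrite /precomp !compDl -!compA p1i1 p2i1.
  by rewrite !comph1 !comph0 !addr0.
move/(congr1 (precomp i2)): fg; rewrite /precomp !compDl -!compA p1i2 p2i2.
by rewrite !comph1 !comph0 !add0r.
Qed.

Lemma indecomposable_biproduct S M N :
  indecomposable S -> biproduct S M N -> hid M = 0 \/ hid N = 0.
Proof.
move=> [_ Si] SMN; have := Si M N (biproduct_hiso SMN (dsum_biproduct M N)).
by rewrite !hzeroP.
Qed.

Lemma indecomposable_id S : indecomposable S -> hid S <> 0.
Proof. by case=> + _; rewrite hzeroP. Qed.

(* The complement of a split monomorphism s is the cone of s. *)
Lemma split_indecomposable W Z (f : hom W Z) (s : hom Z W) :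
  indecomposable W -> hid Z <> 0 -> f \oh s = hid Z -> s \oh f = hid W.
Proof.
move=> Wi Z0 fs; elim/hom_ind: s fs => s fs.
have [ps op so ep eo _ _ _ _] := cone_exact s.
move: (cl s) (cl (cone_in s)) (cl (cone_out s)) fs ps op so ep eo.
move: (cone s) => C {}s p o fs ps op so ep eo.
(* A split monomorphism stays split after the shift, so s[1] o = 0 forces o = 0; hence [p] has a
   section. *)
have o0 : o = 0.
  by rewrite -[o]comp1h -sh_id -fs sh_comp -compA so comph0.
have [|q pq] := eo _ (hid C); first by rewrite comph1.
have [|g gE] := ep _ (hid W - q \oh p).
  by rewrite compBr comph1 compA -pq comp1h subrr.
have gf : g = f \oh (hid W - q \oh p) by rewrite gE compA fs comp1h.
(* Correcting the section [q] so that [f] kills it turns W into the biproduct of Z and the cone; the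
   cone must then be zero, since Z is not. *)
pose q' := q - s \oh (f \oh q).
have fq' : f \oh q' = 0 by rewrite compBr compA fs comp1h subrr.
have pq' : p \oh q' = hid C by rewrite compBr compA ps comp0h subr0.
have ip : s \oh f + q' \oh p = hid W.
  rewrite compBl -!compA addrCA -{1}[f]comph1 -compBr -compBr -gf -gE.
  by rewrite addrC subrK.
have WZC : biproduct W Z C by exists s, q', f, p.
have [//|C0] := indecomposable_biproduct Wi WZC.
by rewrite -ip -[p]comp1h C0 comp0h comph0 addr0.
Qed.

(** Matrices act on row vectors from the right, so for w : Z -> X[1] the rank of [Lmat W w] is the
    dimension of the image of Hom(W, Z) in Hom(W, X[1]). *)
Definition Lmat M N X (g : hom N X) := lin1_mx (@comp _ _ M N X g).
Definition Rmat M N X (f : hom M N) := lin1_mx (@precomp _ _ M N X f).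

Lemma mul_Lmat M N X (g : hom N X) (f : hom M N) : f *m Lmat M g = g \oh f.
Proof. exact: mul_rV_lin1. Qed.
Lemma mul_Rmat M N X (g : hom N X) (f : hom M N) : g *m Rmat X f = g \oh f.
Proof. exact: mul_rV_lin1. Qed.

Lemma rank_exact m n p (F : 'M[k]_(m, n)) (G : 'M[k]_(n, p)) :
  (forall v : 'rV_n, v *m G = 0 <-> exists u, v = u *m F) ->
  n = (\rank F + \rank G)%N.
Proof.
move=> FG; suff -> : \rank F = \rank (kermx G).
  by rewrite mxrank_ker subnK // rank_leq_row.
apply: eqmx_rank; apply/andP; split; apply/rV_subP => v.
  by move=> /submxP[u uE]; apply/sub_kermxP/FG; exists u.
by move=> /sub_kermxP/FG[u ->]; apply: submxMl.
Qed.

Definition Smat n M N := lin1_mx (@sh _ _ n M N).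
Lemma mul_Smat n M N (f : hom M N) : f *m Smat n M N = sh n f.
Proof. exact: mul_rV_lin1. Qed.

Lemma Smat_free n M N : row_free (Smat n M N).
Proof.
apply: inj_row_free => v; rewrite mul_Smat => v0.
by apply: (@sh_inj _ _ n M N); rewrite v0 linear0.
Qed.

Lemma Smat_full n M N : row_full (Smat n M N).
Proof. by rewrite /row_full (eqP (Smat_free n M N)) hom_dim_sh. Qed.

(** * Dimension counts along an exact triangle *)

Section Count.
Variables (X Y Z : perf A) (u : hom X Y) (v : hom Y Z) (w : hom Z (shift X 1)).
Hypothesis uvw : exact_triangle u v w.

(** Rank-nullity at three consecutive terms of the long exact sequence. The connecting map that ends
    in Hom(W, X) is read off after one shift, as postcomposition with [w] on Hom(W[1], Z), whence
    the rank at W[1]. *)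
Lemma count_covariant W :
  (hom_dim W Y + \rank (Lmat (shift W 1) w) + \rank (Lmat W w) =
   hom_dim W X + hom_dim W Z)%N.
Proof.
have [vu wv uw ev ew eu _ _ _] := uvw.
have eY : hom_dim W Y = (\rank (Lmat W u) + \rank (Lmat W v))%N.
  apply: rank_exact => g; rewrite mul_Lmat; split.
    by case/ev=> h ->; exists h; rewrite mul_Lmat.
  by case=> h ->; rewrite mul_Lmat compA vu comp0h.
have eZ : hom_dim W Z = (\rank (Lmat W v) + \rank (Lmat W w))%N.
  apply: rank_exact => g; rewrite mul_Lmat; split.
    by case/ew=> h ->; exists h; rewrite mul_Lmat.
  by case=> h ->; rewrite mul_Lmat compA wv comp0h.
have eX : hom_dim (shift W 1) (shift X 1) =
    (\rank (Lmat (shift W 1) w) + \rank (Lmat (shift W 1) (sh 1 u)))%N.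
  apply: rank_exact => g; rewrite mul_Lmat; split.
    by case/eu=> h ->; exists h; rewrite mul_Lmat.
  by case=> h ->; rewrite mul_Lmat compA uw comp0h.
(* The invertible matrices of the shift intertwine the two postcompositions. *)
have eu' : \rank (Lmat (shift W 1) (sh 1 u)) = \rank (Lmat W u).
  rewrite -(mxrankMfree (Lmat W u) (Smat_free 1 W Y)).
  rewrite -(eqmxMfull _ (Smat_full 1 W X)); congr mxrank.
  apply/row_matrixP => i; rewrite !rowE !mulmxA mul_Smat mul_Lmat mul_Lmat.
  by rewrite mul_Smat sh_comp.
have := hom_dim_sh 1 W X; lia.
Qed.

(** The sequence continues from Hom(X, V) to Hom(Z, V[1]) by sending g to g[1] w, which accounts for
    the rank at V[1]. *)
Lemma count_contravariant V :
  (hom_dim Y V + \rank (Rmat V w) + \rank (Rmat (shift V 1) w) =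
   hom_dim Z V + hom_dim X V)%N.
Proof.
have [vu wv uw _ _ _ cu cv cw] := uvw.
have eY : hom_dim Y V = (\rank (Rmat V v) + \rank (Rmat V u))%N.
  apply: rank_exact => g; rewrite mul_Rmat; split.
    by case/cu=> h ->; exists h; rewrite mul_Rmat.
  by case=> h ->; rewrite mul_Rmat -compA vu comph0.
have eZ : hom_dim Z V = (\rank (Rmat V w) + \rank (Rmat V v))%N.
  apply: rank_exact => g; rewrite mul_Rmat; split.
    by case/cv=> h ->; exists h; rewrite mul_Rmat.
  by case=> h ->; rewrite mul_Rmat -compA wv comph0.
have eX : hom_dim X V =
    (\rank (Rmat V u) + \rank (Smat 1 X V *m Rmat (shift V 1) w))%N.
  apply: rank_exact => g; rewrite mulmxA mul_Smat mul_Rmat; split.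
    by case/cw=> h ->; exists h; rewrite mul_Rmat.
  by case=> h ->; rewrite mul_Rmat sh_comp -compA uw comph0.
rewrite (eqmxMfull _ (Smat_full 1 X V)) in eX; lia.
Qed.

End Count.
End Triangles.

(** * Auslander-Reiten triangles *)

Section Indecomposable.
Variables (k : fieldType) (A : falgType k).
Implicit Types (M N X Y Z W V S : perf A).

Lemma biproduct_iso S S' M N : hiso S S' -> biproduct S M N -> biproduct S' M N.
Proof.
move=> /hisoP[f [g [gf fg]]] [i1 [i2 [p1 [p2 [p1i1 p2i2 p1i2 p2i1 ip]]]]].
have gfK T (h : hom T S) : g \oh (f \oh h) = h by rewrite compA gf comp1h.
exists (f \oh i1), (f \oh i2), (p1 \oh g), (p2 \oh g); split.
- by rewrite -compA gfK.
- by rewrite -compA gfK.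
- by rewrite -compA gfK.
- by rewrite -compA gfK.
have fhg T (h : hom T S) (h' : hom S T) :
    f \oh h \oh (h' \oh g) = f \oh (h \oh h') \oh g by rewrite !compA.
by rewrite !fhg -compDl -compDr ip comph1.
Qed.

Lemma biproduct_shift n S M N :
  biproduct S M N -> biproduct (shift S n) (shift M n) (shift N n).
Proof.
move=> [i1 [i2 [p1 [p2 [p1i1 p2i2 p1i2 p2i1 ip]]]]].
exists (sh n i1), (sh n i2), (sh n p1), (sh n p2).
rewrite -!sh_comp -linearD /= p1i1 p2i2 p1i2 p2i1 ip !sh_id.
by split=> //; rewrite linear0.
Qed.

Lemma hid_shift n M : hid (shift M n) = 0 <-> hid M = 0.
Proof.
rewrite -sh_id; split=> [e|->]; last by rewrite linear0.
by apply: (@sh_inj _ _ n M M); rewrite e linear0.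
Qed.

Lemma hid_hiso M N : hiso M N -> hid M = 0 -> hid N = 0.
Proof.
move=> /hisoP[f [g [_ fg]]] M0.
by rewrite -fg -[f]comph1 M0 comph0 comp0h.
Qed.

Lemma indecomposable_hiso M N : hiso M N -> indecomposable M -> indecomposable N.
Proof.
move=> MN Mi; split.
  by rewrite hzeroP => /(hid_hiso (hiso_sym MN)); apply: indecomposable_id.
by move=> X Y NXY; apply: (proj2 Mi); apply: hiso_trans NXY.
Qed.

Lemma indecomposable_shift n M : indecomposable M -> indecomposable (shift M n).
Proof.
move=> Mi; split; first by rewrite hzeroP hid_shift; apply: indecomposable_id.
move=> X Y MXY; rewrite !hzeroP.
have := biproduct_iso (hiso_sym MXY) (dsum_biproduct X Y).
move=> /(biproduct_shift (- n)) /(biproduct_iso (hiso_unsh n M)).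
by move=> /(indecomposable_biproduct Mi); rewrite !hid_shift.
Qed.

(** Once the absolute value of i exceeds the sum of the two bounds, W and V[i] live in disjoint
    degrees. *)
Lemma hom_dim_bounded W V :
  exists b : nat, forall i : int, b%:Z < `|i| -> hom_dim W (shift V i) = 0%N.
Proof.
have [a aP] := term_bounded W; have [b bP] := term_bounded V.
exists (a + b)%N => i lt_i.
have all0 (f : hom W (shift V i)) : f = 0.
  elim/hom_ind: f => f; rewrite -cl_czero; apply: cl_ext => j x.
  have [lt_j|le_j] := ltP a%:Z `|j|; first by rewrite (aP j lt_j x) !linear0.
  apply: (bP (j + i)); suff: `|i| <= `|j + i| + `|j| by lia.
  by rewrite -{1}[i](addKr j) addrC ler_normB.
apply/eqP; rewrite -leqn0.
apply: (@leq_dim_lin k _ 0 (fun=> 0)) => [c f g|f g _].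
  by rewrite scaler0 addr0.
by rewrite (all0 f) (all0 g).
Qed.

Lemma hom_dim_id M : hid M <> 0 -> (0 < hom_dim M M)%N.
Proof.
move=> M0; rewrite lt0n; apply/eqP => d0; apply: M0.
by apply/rowP => j; have := ltn_ord j; rewrite [X in (_ < X)%N]d0.
Qed.

(** Iterating the isomorphism makes M isomorphic to M[i n] for all n, so Hom(M, M[i n]) has the
    nonzero dimension of End(M); for i != 0 this contradicts boundedness. *)
Lemma shift_aperiodic M i : hid M <> 0 -> hiso M (shift M i) -> i = 0.
Proof.
move=> M0 Mi; have [b bP] := hom_dim_bounded M M.
have Mn (n : nat) : hiso M (shift M (i *+ n)).
  elim: n => [|n IH]; first by rewrite mulr0n; apply/hiso_sym/hiso_shift0.
  apply: hiso_trans Mi _; rewrite mulrSr.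
  exact: hiso_trans (hiso_shift i IH) (hiso_shift_add _ _ _).
apply/eqP; apply: contraT => i0; have := hom_dim_id M0.
rewrite (hom_dim_isor _ (Mn b.+1)) bP // normrMn -mulr_natl natz.
suff: 1 <= `|i| by nia.
by rewrite -gtz0_ge1 normr_gt0.
Qed.

End Indecomposable.

(** * The connecting map of an Auslander-Reiten triangle *)

Section AuslanderReiten.
Variables (k : closedFieldType) (A : falgType k).
Implicit Types (M N X Y Z W V S : perf A).

(** End(Z) is finite dimensional, and one-sided inverses of square matrices are two-sided. *)
Lemma one_sided_inverse Z (e s : hom Z Z) : e \oh s = hid Z -> s \oh e = hid Z.
Proof.
move=> es; have /mulmx1C es1 : Lmat Z s *m Lmat Z e = 1%:M.
  by apply/row_matrixP => i; rewrite !rowE mulmxA !mul_Lmat compA es comp1h mulmx1.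
by rewrite -[s \oh e]comph1 -compA -!mul_Lmat -mulmxA es1 mulmx1.
Qed.

(** [a] is an eigenvalue of postcomposition with [e] on the nonzero space End(Z). An eigenvector is
    killed by e - a, so e - a is not invertible. *)
Lemma eigen_not_split Z (e : hom Z Z) : hid Z <> 0 ->
  exists a : k, forall s, (e - a *: hid Z) \oh s <> hid Z.
Proof.
move=> Z0; have /closed_rootP[a] : size (char_poly (Lmat Z e)) != 1%N.
  by rewrite size_char_poly eqSS -lt0n hom_dim_id.
rewrite -eigenvalue_root_char => /eigenvalueP[x xe x0].
exists a => s /one_sided_inverse es; move/eqP: x0; apply.
rewrite -[x]comp1h -es -compA compBl compZl comp1h -(mul_Lmat e) xe.
by rewrite subrr comph0.
Qed.

Section Triangle.
Variables (X Y Z : perf A) (u : hom X Y) (v : hom Y Z) (w : hom Z (shift X 1)).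
Hypothesis uvw : exact_triangle u v w.
Hypothesis Z0 : hid Z <> 0.
Hypothesis Zi : indecomposable Z.
Hypothesis w0 : w <> 0.
Hypothesis almost_split : forall W (f : hom W Z),
  (forall s, f \oh s <> hid Z) -> exists g, f = v \oh g.
Hypothesis XZ : hiso (shift X 1) Z.

Lemma right_almost_split W (f : hom W Z) :
  (forall s, f \oh s <> hid Z) -> w \oh f = 0.
Proof. by case/almost_split=> g ->; rewrite compA (tri_wv uvw) comp0h. Qed.

(* The endomorphisms killed by w form the radical of End(Z). *)
Lemma local_end (e : hom (shift X 1) (shift X 1)) :
  (exists r, r \oh e = hid _) \/ (exists r, r \oh (hid _ - e) = hid _).
Proof.
have [f [g [gf fg]]] := (hisoP _ _).1 XZ.
(* An endomorphism of Z not killed by [w] splits and so is invertible; [f] and [g] transport this to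
   X[1]. *)
have inv (e' : hom (shift X 1) (shift X 1)) :
    w \oh (f \oh e' \oh g) <> 0 -> exists r, r \oh e' = hid _.
  move=> we; apply: contrapT => nr; apply: we.
  apply: right_almost_split => s /one_sided_inverse se; apply: nr.
  exists (g \oh s \oh f); rewrite -[RHS]gf -[f in RHS]comp1h -se.
  by rewrite -!compA gf comph1.
have [|e0] := pselect (w \oh (f \oh e \oh g) = 0); last by left; apply: inv.
(* As [w] kills the transport of [e], it takes the transport of 1 - e to [w] itself, which is
   nonzero. *)
move=> e0; right; apply: inv.
by rewrite compBr compBl compBr e0 subr0 comph1 fg comph1.
Qed.

(* If g = f w is not 0, then the map from cone(g)[-1] to Z is not a split
   epimorphism, so w kills it and hence w = b g = (b f) w for some b. As End(X[1])
   is local, b f is invertible. *)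
Lemma left_almost_split V (f : hom (shift X 1) V) :
  (forall r, r \oh f <> hid _) -> f \oh w = 0.
Proof.
move=> nf; apply: contrapT => g0.
have [g gE] : exists g, f \oh w = cl g by exists (rep (f \oh w)); rewrite cl_rep.
have [_ _ go _ _ _ _ _ cw] := cone_exact g.
move: (cone g) (cl (cone_out g)) go cw => K o; rewrite -gE => go cw.
(* [q] is the map cone(g)[-1] -> Z that precedes [g] in its triangle. *)
pose q : hom (shift K (- 1)) Z := unsh 1 Z \oh sh (- 1) o.
have qE T (h : hom Z T) : h \oh q = unsh 1 T \oh sh (- 1) (sh 1 h \oh o).
  by rewrite compA -unsh_natural -compA -sh_comp.
have wq : w \oh q = 0.
  apply: right_almost_split => s qs; apply: g0.
  by rewrite -[LHS]comph1 -qs compA qE go linear0 comph0 comp0h.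
have wo : sh 1 w \oh o = 0.
  apply: (@sh_inj _ _ (- 1)); rewrite linear0.
  have [i [iu _]] := unsh_iso 1 (shift X 1).
  by rewrite -[LHS]comp1h -iu -compA -qE wq comph0.
have [b bE] := cw _ _ wo.
have [[r rE]|[r rE]] := local_end (b \oh f).
  by apply: (nf (r \oh b)); rewrite -compA.
by apply: w0; rewrite -[w]comp1h -rE -compA compBl comp1h -compA -bE subrr comph0.
Qed.

Lemma rank_postcomp W : indecomposable W ->
  \rank (Lmat W w) = `[< hiso W Z >].
Proof.
move=> Wi; have [/asboolP/hisoP[f [g [gf fg]]]|/asboolPn nWZ] := boolP `[< hiso W Z >].
  (* The image is spanned by [w f]: h = (h g) f, and h g is a scalar plus a map killed by [w]. *)
  rewrite (_ : \rank _ = \rank (w \oh f)).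
    rewrite rank_rV; case: eqP => // wf; case: w0.
    by rewrite -[w]comph1 -fg compA wf comp0h.
  apply: eqmx_rank; apply/andP; split; last by rewrite -mul_Lmat submxMl.
  apply/rV_subP => _ /submxP[h ->]; rewrite mul_Lmat.
  have [a aP] := eigen_not_split (h \oh g) Z0.
  have := right_almost_split aP.
  rewrite compBr compZr comph1 compA => /eqP; rewrite subr_eq0 => /eqP whg.
  by rewrite -[h]comph1 -gf !compA whg compZl scalemx_sub.
suff -> : Lmat W w = 0 by rewrite mxrank0.
apply/row_matrixP => i; rewrite rowE mul_Lmat row0.
(* A section would make this map from an indecomposable object an isomorphism. *)
apply: right_almost_split => s fs; apply/nWZ/hisoP.
by exists (delta_mx 0 i), s; rewrite (split_indecomposable Wi Z0 fs).
Qed.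

Lemma rank_precomp V : indecomposable V ->
  \rank (Rmat V w) = `[< hiso V Z >].
Proof.
move=> Vi; have X0 : hid (shift X 1) <> 0 by move=> /(hid_hiso XZ).
have XV : hiso V Z <-> hiso (shift X 1) V.
  split=> h; first exact: hiso_trans XZ (hiso_sym h).
  exact: hiso_trans (hiso_sym h) XZ.
have [/asboolP/XV/hisoP[f [g [gf fg]]]|/asboolPn nVZ] := boolP `[< hiso V Z >].
  rewrite (_ : \rank _ = \rank (f \oh w)).
    rewrite rank_rV; case: eqP => // wf; case: w0.
    by rewrite -[w]comp1h -gf -compA wf comph0.
  apply: eqmx_rank; apply/andP; split; last by rewrite -mul_Rmat submxMl.
  apply/rV_subP => _ /submxP[h ->]; rewrite mul_Rmat.
  have [a aP] := eigen_not_split (g \oh h) X0.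
  have /left_almost_split : forall r, r \oh (g \oh h - a *: hid _) <> hid (shift X 1).
    by move=> r /one_sided_inverse; apply: aP.
  rewrite compBl compZl comp1h => /eqP; rewrite subr_eq0 => /eqP ghw.
  by rewrite -[h]comp1h -fg -!compA [g \oh _]compA ghw compZr scalemx_sub.
suff -> : Rmat V w = 0 by rewrite mxrank0.
apply/row_matrixP => i; rewrite rowE mul_Rmat row0.
apply: left_almost_split => r fr; apply/nVZ/XV/hisoP.
by exists (delta_mx 0 i), r; rewrite (split_indecomposable Vi X0 fr).
Qed.

End Triangle.

Lemma AR_hom X Y Z : has_AR_triangle X Y Z ->
  indecomposable Z /\
  exists (u : hom X Y) (v : hom Y Z) (w : hom Z (shift X 1)),
    [/\ exact_triangle u v w, w <> 0 &
        forall W (f : hom W Z), (forall s, f \oh s <> hid Z) ->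
          exists g, f = v \oh g].
Proof.
move=> [u [v [w [/distinguished_exact uvw [_ Zi] w0 AR]]]]; split=> //.
exists (cl u), (cl v), (cl w); split=> //; first by move/cl0P.
move=> W; elim/hom_ind=> f fs.
have [|g /clP fg] := AR W f; first by move=> /split_epiP[s /fs].
by exists (cl g); rewrite compE.
Qed.

Lemma AR_count_covariant X Y Z W :
  has_AR_triangle X Y Z -> hiso (shift X 1) Z -> indecomposable W ->
  (hom_dim W Y + `[< hiso (shift W 1) Z >] + `[< hiso W Z >] =
   hom_dim W X + hom_dim W Z)%N.
Proof.
move=> /AR_hom[Zi [u [v [w [uvw w0 AR]]]]] XZ Wi.
have Z0 := indecomposable_id Zi.
rewrite -(count_covariant uvw W) (rank_postcomp uvw Z0 w0 AR Wi).
by rewrite (rank_postcomp uvw Z0 w0 AR (indecomposable_shift 1 Wi)).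
Qed.

Lemma AR_count_contravariant X Y Z V :
  has_AR_triangle X Y Z -> hiso (shift X 1) Z -> indecomposable V ->
  (hom_dim Y V + `[< hiso V Z >] + `[< hiso (shift V 1) Z >] =
   hom_dim Z V + hom_dim X V)%N.
Proof.
move=> /AR_hom[Zi [u [v [w [uvw w0 AR]]]]] XZ Vi.
have Z0 := indecomposable_id Zi.
rewrite -(count_contravariant uvw V) (rank_precomp uvw Z0 w0 AR XZ Vi).
by rewrite (rank_precomp uvw Z0 w0 AR XZ (indecomposable_shift 1 Vi)).
Qed.

End AuslanderReiten.

(** * The recurrence *)

Section Recurrence.
Variables (F : fieldType) (x d : F) (P : nat -> nat -> F).
Hypothesis x0 : x != 0.
Hypothesis x1 : forall n, 1 - x ^+ n.+1 != 0.

Let geo (r : nat) : F := \sum_(i < r.+1) x ^+ i.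
Let geoV (r : nat) : F := \sum_(i < r.+1) x ^- i.

Lemma geoE r : geo r = (1 - x ^+ r.+1) / (1 - x).
Proof.
apply: (mulIf (x1 0%N)); rewrite expr1 divfK; last by have := x1 0%N; rewrite expr1.
rewrite /geo; elim: r => [|r IH]; first by rewrite big_ord1 expr0 expr1 mul1r.
by rewrite big_ord_recr mulrDl IH /= !exprS; ring.
Qed.

Lemma geoVE r : geoV r = (1 - x ^+ r.+1) / (1 - x) / x ^+ r.
Proof.
have h1 : 1 - x != 0 by have := x1 0%N; rewrite expr1.
rewrite /geoV; elim: r => [|r IH].
  by rewrite big_ord1 expr0 expr1 invr1 mulr1 divff.
rewrite big_ord_recr IH /= !exprS; field.
by rewrite x0 h1 expf_neq0.
Qed.

Definition closed_form (m n : nat) : F :=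
  geo m * geoV n *
  (P 0%N 0%N - d * ((1 + x) * (1 - x ^+ maxn m n) / (1 - x ^+ (maxn m n).+1))).

(* The correction d is 1 within one component and 0 between two of them. *)
Hypothesis rec_l0 : P 1%N 0%N + (1 + x) * d = (1 + x) * P 0%N 0%N.
Hypothesis rec_lS : forall m, P m.+2 0%N + x * P m 0%N = (1 + x) * P m.+1 0%N.
Hypothesis rec_r0 : forall m,
  x * P m 1%N + (1 + x) * (d *+ (m == 0%N)) = (1 + x) * P m 0%N.
Hypothesis rec_rS : forall m n,
  P m n + x * P m n.+2 + (1 + x) * (d *+ (m == n.+1)) = (1 + x) * P m n.+1.

Lemma two_step (Q : nat -> Prop) :
  Q 0%N -> Q 1%N -> (forall n, Q n -> Q n.+1 -> Q n.+2) -> forall n, Q n.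
Proof.
move=> Q0 Q1 QS n; suff: Q n /\ Q n.+1 by case.
by elim: n => [//|n [Qn Qn1]]; split=> //; apply: QS.
Qed.

(** The boundary column n = 0 is a second-order recurrence in m, and the correction enters only
    through its starting value at m = 1, given by [rec_l0]. *)
Lemma closed_form_l m : P m 0%N = closed_form m 0%N.
Proof.
have h1 : 1 - x != 0 by have := x1 0%N; rewrite expr1.
elim/two_step: m => [||m IH0 IH1].
- rewrite /closed_form geoE geoVE maxn0 !expr0 expr1.
  by field; rewrite ?h1 ?oner_neq0.
- rewrite /closed_form geoE geoVE maxn0 !expr0 expr1.
  have h2 := x1 1%N.
  rewrite -[LHS](addrK ((1 + x) * d)) rec_l0.
  by field; rewrite ?h1 ?h2 ?oner_neq0.
rewrite -[LHS](addrK (x * P m 0%N)) rec_lS IH0 IH1.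
rewrite /closed_form !geoE geoVE !maxn0 !expr0 expr1.
have h2 := x1 m; have h3 := x1 m.+1; have h4 := x1 m.+2.
rewrite !exprS in h2 h3 h4 *.
by field; rewrite ?h1 ?h2 ?h3 ?h4 ?oner_neq0.
Qed.

(** For fixed m the recurrence in n is of second order, with the column n = 0 and [rec_r0] as
    starting data. *)
Lemma closed_formP m n : P m n = closed_form m n.
Proof.
have h1 : 1 - x != 0 by have := x1 0%N; rewrite expr1.
have xn n' : x ^+ n' != 0 by rewrite expf_neq0.
elim/two_step: n => [||n IH0 IH1]; first exact: closed_form_l.
- apply: (mulfI x0); rewrite -[LHS](addrK ((1 + x) * (d *+ (m == 0%N)))) rec_r0.
  rewrite closed_form_l /closed_form geoE !geoVE maxn0.
  case: m => [|m].
    have h2 := x1 1%N; rewrite max0n eqxx mulr1n !expr0 expr1.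
    by field; rewrite ?x0 ?h1 ?h2 ?oner_neq0.
  rewrite (maxn_idPl _) // mulr0n !expr0 expr1.
  have h2 := x1 m.+1; rewrite !exprS in h2 *.
  by field; rewrite ?x0 ?h1 ?h2 ?oner_neq0.
apply: (mulfI x0).
have -> : x * P m n.+2 =
    (1 + x) * P m n.+1 - P m n - (1 + x) * (d *+ (m == n.+1)).
  by rewrite -rec_rS; ring.
rewrite IH0 IH1 /closed_form geoE !geoVE.
have h2 := x1 m; have hn := xn n.
(* The term in [d] enters only at m = n + 1, which is where the maximum of m and the second index
   passes from being constant to growing. *)
have [lt_mn|lt_nm|->] := ltngtP m n.+1.
- have [-> ->] : maxn m n = n /\ maxn m n.+2 = n.+2 by lia.
  have h3 := x1 n; have h4 := x1 n.+1; have h5 := x1 n.+2.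
  rewrite mulr0n !exprS in h3 h4 h5 *.
  by field; rewrite ?x0 ?h1 ?h3 ?h4 ?h5 ?hn ?oner_neq0.
- have [-> ->] : maxn m n = m /\ maxn m n.+2 = m by lia.
  rewrite mulr0n !exprS in h2 *.
  by field; rewrite ?x0 ?h1 ?h2 ?hn ?oner_neq0.
have [-> ->] : maxn n.+1 n = n.+1 /\ maxn n.+1 n.+2 = n.+2 by lia.
have h3 := x1 n; have h4 := x1 n.+1; have h5 := x1 n.+2.
rewrite mulr1n !exprS in h3 h4 h5 *.
by field; rewrite ?x0 ?h1 ?h4 ?h5 ?hn ?oner_neq0.
Qed.

End Recurrence.

(** * Pairings and labelled components *)

Lemma t_neq0 : t != 0.
Proof. by rewrite /t tofrac_eq0 polyX_eq0. Qed.

Lemma t_exp_neq1 n : 1 - t ^+ n.+1 != 0.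
Proof.
rewrite /t -tofracXn -tofrac1 -tofracB tofrac_eq0 -oppr_eq0 opprB.
by rewrite -size_poly_eq0 size_XnsubC.
Qed.

(** * Substituting t^-1 in polynomials and fractions *)

Lemma eval_invE (p : {poly rat}) : eval_inv p = \sum_(i < size p) tofrac (p`_i)%:P * t ^- i.
Proof.
rewrite /eval_inv horner_coef size_map_inj_poly //=.
  by apply: eq_bigr => i _; rewrite coef_map_id0 ?exprVn // polyC0 tofrac0.
by move=> a b /eqP; rewrite tofrac_eq => /eqP/polyC_inj.
Qed.

Lemma eval_invM p q : eval_inv (p * q) = eval_inv p * eval_inv q.
Proof.
by rewrite /eval_inv -hornerM -(rmorphM (map_poly (@tofrac _ \o polyC))).
Qed.

(** Multiplying by t to the degree of [p] gives the reversed polynomial, whose constant term is the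
    leading coefficient of [p]. *)
Lemma eval_inv_neq0 p : p != 0 -> eval_inv p != 0.
Proof.
move=> p0; have s0 : (0 < size p)%N by rewrite size_poly_gt0.
pose q := \sum_(i < size p) (p`_i)%:P * 'X^((size p).-1 - i) : {poly rat}.
have qE : tofrac q = eval_inv p * t ^+ (size p).-1.
  rewrite eval_invE rmorph_sum mulr_suml; apply: eq_bigr => i _ /=.
  rewrite tofracM tofracXn -mulrA; congr (_ * _).
  have le_i : (i <= (size p).-1)%N by rewrite -ltnS prednK.
  rewrite -/t -[in RHS](subnK le_i) exprD [RHS]mulrC mulfK //.
  exact: expf_neq0 t_neq0.
have : tofrac q != 0.
  rewrite tofrac_eq0; apply/eqP => /(congr1 (fun r : {poly rat} => r`_0)).
  rewrite coef_sum coef0 -(prednK s0) big_ord_recr big1 /= => [|i _].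
    rewrite add0r subnn expr0 mulr1 coefC /=.
    by apply/eqP; rewrite -[_`_ _]/(lead_coef p) lead_coef_eq0.
  rewrite coefMXn subn_gt0 (leq_trans (ltn_ord i)) //.
by rewrite qE; apply: contra_neq => ->; rewrite mul0r.
Qed.

(** The representative chosen for [p] is some fraction equivalent to p / 1; cross-multiplication
    gives this identity, after which the denominator cancels in [bar]. *)
Lemma repr_tofrac (R : idomainType) (p : R) (r := repr (tofrac p)) :
  (frac r).1 = (frac r).2 * p.
Proof.
rewrite /r; have E : tofrac p = (\pi_(FracField.type R) (Ratio p 1))%qT.
  by rewrite piE.
have := FracField.equivf_l (Ratio p 1).
by rewrite -E !numden_Ratio ?oner_neq0 // mulr1.
Qed.

Lemma bar_tofrac p : bar (tofrac p) = eval_inv p.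
Proof.
rewrite /bar repr_tofrac eval_invM mulrAC divff ?mul1r //.
exact/eval_inv_neq0/denom_ratioP.
Qed.

Lemma bar_sigma n : bar (sigma n) = \sum_(i < n.+1) t ^- i.
Proof.
have -> : sigma n = tofrac (\poly_(i < n.+1) 1).
  rewrite poly_def rmorph_sum; apply: eq_bigr => i _.
  by rewrite scale1r /= tofracXn.
rewrite bar_tofrac eval_invE size_poly_eq ?oner_neq0 //.
by apply: eq_bigr => i _; rewrite coef_poly ltn_ord polyC1 tofrac1 mul1r.
Qed.

(** * Generating Laurent polynomials of finitely supported functions on the integers *)

Section Series.

Definition bounded (f : int -> nat) := exists b : nat,
  forall i : int, b%:Z < `|i| -> f i = 0%N.

(** A pairing unfolds to the [series] of its dimension function, so identities between dimensions
    can be summed degree by degree. *)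
Definition series (f : int -> nat) : Qt := \sum_(i \in [set: int]) t ^ i *+ f i.

(** Additivity of a sum over all integers needs finite supports; two bounded functions are compared
    on a common window from -b to b. *)
Lemma series_window (f : int -> nat) (b : nat) :
  (forall i : int, b%:Z < `|i| -> f i = 0%N) ->
  series f = \sum_(l < (b + b).+1) t ^ (l%:Z - b%:Z) *+ f (l%:Z - b%:Z).
Proof.
move=> fb; rewrite /series (fsbigE [seq l%:Z - b%:Z | l <- iota 0 (b + b).+1]).
- rewrite big_map -[iota _ _]/(index_iota 0 (b + b).+1) big_mkord.
  by apply: eq_bigl => l; rewrite in_setT.
- by rewrite map_inj_uniq ?iota_uniq // => l m /addIr [].
- by [].
move=> i _ ni; rewrite fb ?mulr0n // ltNge; apply: contra ni => ib.
apply/mapP; exists (absz (i + b%:Z)); first by rewrite mem_iota; lia.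
lia.
Qed.

Lemma bounded_max f g : bounded f -> bounded g -> exists b : nat,
  forall i : int, b%:Z < `|i| -> f i = 0%N /\ g i = 0%N.
Proof.
move=> [a fa] [b gb]; exists (a + b)%N => i ib.
by split; [apply: fa|apply: gb]; lia.
Qed.

Lemma boundedD f g : bounded f -> bounded g -> bounded (fun i => f i + g i)%N.
Proof.
by move=> bf /(bounded_max bf)[b bP]; exists b => i /bP[-> ->].
Qed.

Lemma bounded_shift f c : bounded f -> bounded (fun i => f (i + c)).
Proof. by move=> [b fb]; exists (b + absz c)%N => i ib; apply: fb; lia. Qed.

Lemma seriesD f g : bounded f -> bounded g ->
  series (fun i => f i + g i)%N = series f + series g.
Proof.
move=> bf bg; have [b bP] := bounded_max bf bg.
rewrite !(@series_window _ b).
- by rewrite -big_split; apply: eq_bigr => l _; rewrite mulrnDr.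
- by move=> i /bP[].
- by move=> i /bP[].
by move=> i /bP[-> ->].
Qed.

Lemma eq_series f g : f =1 g -> series f = series g.
Proof. by move=> fg; apply: eq_fsbigr => i _; rewrite fg. Qed.

Lemma series_shift f c : series (fun i => f (i + c)) = t ^ (- c) * series f.
Proof.
rewrite /series mulr_fsumr [RHS](reindex_fsbigT (fun i : int => i + c)).
  apply: eq_fsbigr => i _.
  by rewrite mulrnAr -expfzDr ?t_neq0 // addrCA addNr addr0.
by exists (fun i => i - c) => i; rewrite ?addrK ?subrK.
Qed.

Lemma series_delta (b : bool) : series (fun i => (b && (i == 0)) : nat) = b%:R.
Proof.
rewrite (@series_window _ 0) => [|i i0]; first by rewrite big_ord1 subrr expr0z andbT.
by case: eqP => [i1|]; rewrite ?andbF //; move: i0; rewrite i1 normr0.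
Qed.

End Series.

(** * Walks in the Auslander-Reiten quiver *)

Section Walks.
Variables (k : fieldType) (A : falgType k).
Implicit Types (M N X Y Z W V : perf A).

Lemma irreducible_mapP M N (f : chain_map M N) :
  irreducible_map f <->
  [/\ forall r, r \oh cl f <> hid M, forall s, cl f \oh s <> hid N &
      forall X (g : hom M X) (h : hom X N), cl f = h \oh g ->
        (exists r, r \oh g = hid M) \/ (exists s, h \oh s = hid N)].
Proof.
have sm X Y (h : chain_map X Y) := propext (split_monoP h).
have se X Y (h : chain_map X Y) := propext (split_epiP h).
rewrite /irreducible_map sm se; split=> -[nm ne fac].
  split=> [r rf|s fs|X]; [by apply: nm; exists r|by apply: ne; exists s|].
  elim/hom_ind=> g; elim/hom_ind=> h; rewrite compE => /clP/fac.
  by rewrite sm se.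
split=> [[r /nm]//|[s /ne]//|X g h /clP].
by rewrite -compE sm se; apply: fac.
Qed.

(** Conjugation by isomorphisms keeps a map irreducible; this makes walks depend on isomorphism
    classes only. *)
Lemma arrow_hiso M M' N N' :
  hiso M M' -> hiso N N' -> arrow M N -> arrow M' N'.
Proof.
move=> MM NN [Mi Ni [f /irreducible_mapP[nm ne fac]]].
split; [exact: indecomposable_hiso Mi|exact: indecomposable_hiso Ni|].
have [a [a' [a'a aa']]] := (hisoP _ _).1 MM.
have [b [b' [b'b bb']]] := (hisoP _ _).1 NN.
exists (rep (b \oh cl f \oh a')); apply/irreducible_mapP; rewrite cl_rep.
have fE : b' \oh (b \oh cl f \oh a') \oh a = cl f.
  by rewrite -!compA a'a comph1 compA b'b comp1h.
split=> [r rf|s fs|X g h fgh].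
- apply: (nm (a' \oh r \oh b)).
  have: a' \oh (r \oh (b \oh cl f \oh a')) \oh a = hid M by rewrite rf comph1.
  by rewrite -!compA a'a comph1.
- apply: (ne (a' \oh s \oh b)).
  have: b' \oh ((b \oh cl f \oh a') \oh s) \oh b = hid N by rewrite fs comph1.
  by rewrite !compA b'b comp1h.
have [|[r rg]|[s hs]] := fac X (g \oh a) (b' \oh h).
- by rewrite -fE fgh !compA.
- left; exists (a \oh r).
  have: a \oh (r \oh (g \oh a)) \oh a' = hid M' by rewrite rg comph1.
  by rewrite -!compA aa' comph1.
right; exists (s \oh b').
have: b \oh ((b' \oh h) \oh s) \oh b' = hid N' by rewrite hs comph1.
by rewrite !compA bb' comp1h.
Qed.

Lemma walk_hisor n M N N' : hiso N N' -> walk n M N -> walk n M N'.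
Proof.
case: n => [|n] NN /=; first by move=> MN; apply: hiso_trans MN NN.
case=> X [MX XN]; exists X; split=> //.
by case: XN => h; [left|right]; apply: arrow_hiso h => //; apply: hiso_refl.
Qed.

Lemma walk_cons n M M' N :
  arrow M M' \/ arrow M' M -> walk n M' N -> walk n.+1 M N.
Proof.
move=> MM; elim: n N => [|n IH] N /=.
  move=> MN; exists M; split; first exact: hiso_refl.
  by case: MM => h; [left|right]; apply: arrow_hiso h => //; apply: hiso_refl.
by case=> X [/IH MX XN]; exists X.
Qed.

Lemma walk_sym n M N : walk n M N -> walk n N M.
Proof.
elim: n N => [|n IH] N; first exact: hiso_sym.
by case=> X [/IH XM XN]; apply: walk_cons XM; case: XN; [right|left].
Qed.

Lemma walk_trans n m M N X : walk n M N -> walk m N X -> walk (n + m) M X.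
Proof.
move=> MN; elim: m X => [|m IH] X; first by rewrite addn0 => /walk_hisor; apply.
by case=> Y [/IH MY YX]; rewrite addnS; exists Y.
Qed.

Lemma same_component_sym M N : same_component M N -> same_component N M.
Proof. by case=> n /walk_sym; exists n. Qed.

Lemma same_component_trans M N X :
  same_component M N -> same_component N X -> same_component M X.
Proof. by move=> [n MN] [m NX]; exists (n + m)%N; apply: walk_trans NX. Qed.

Lemma rim_distance_exists M X :
  on_rim M -> same_component M X -> exists n, rim_distance X n.
Proof.
move=> Mr [n MX].
have ex : exists n, `[< exists R, on_rim R /\ walk n R X >].
  by exists n; apply/asboolP; exists M.
case: (ex_minnP ex) => m /asboolP mX min_m; exists m; split=> // p lt_pm pX.
have := min_m p (introT (asboolP _) pX); lia.
Qed.

Lemma rim_distance_uniq X m n : rim_distance X m -> rim_distance X n -> m = n.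
Proof.
move=> [mX mmin] [nX nmin]; have [lt_mn|lt_nm|//] := ltngtP m n.
  by case: (nmin m lt_mn).
by case: (mmin n lt_nm).
Qed.

End Walks.

(** * Recurrences for the pairing *)

Section Pairing.
Variables (k : closedFieldType) (A : falgType k).
Implicit Types (M N X Y Z W V S : perf A).

Definition hdim W V (i : int) : nat := hom_dim W (shift V i).

Lemma bounded_hdim W V : bounded (hdim W V).
Proof. exact: hom_dim_bounded. Qed.

Lemma hdim_shiftr W V b i : hdim W (shift V b) i = hdim W V (i + b).
Proof. by rewrite /hdim (hom_dim_isor _ (hiso_shift_add V b i)) addrC. Qed.

Lemma hdim_shiftl W V a i : hdim (shift W a) V i = hdim W V (i - a).
Proof. exact: hom_dim_shift. Qed.

Lemma hdim_iso W W' V V' i : hiso W W' -> hiso V V' -> hdim W V i = hdim W' V' i.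
Proof.
move=> WW VV; rewrite /hdim (hom_dim_isol _ WW).
exact/hom_dim_isor/hiso_shift.
Qed.

Lemma pairing_iso W W' V V' : hiso W W' -> hiso V V' -> pairing W V = pairing W' V'.
Proof. by move=> WW VV; apply: eq_series => i; apply: hdim_iso. Qed.

Lemma pairing_shiftr W V b : pairing W (shift V b) = t ^ (- b) * pairing W V.
Proof. by rewrite -series_shift; apply: eq_series => i; apply: hdim_shiftr. Qed.

Lemma pairing_shiftl W V a : pairing (shift W a) V = t ^ a * pairing W V.
Proof.
rewrite -{2}[a]opprK -series_shift; apply: eq_series => i.
exact: hdim_shiftl.
Qed.

Lemma pairing_biproductr W S M N : biproduct S M N ->
  pairing W S = pairing W M + pairing W N.
Proof.
move=> SMN; rewrite -(seriesD (bounded_hdim W M) (bounded_hdim W N)).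
by apply: eq_series => i; apply/hom_dim_biproductr/biproduct_shift.
Qed.

Lemma pairing_biproductl W S M N : biproduct S M N ->
  pairing S W = pairing M W + pairing N W.
Proof.
move=> SMN; rewrite -(seriesD (bounded_hdim M W) (bounded_hdim N W)).
by apply: eq_series => i; apply/hom_dim_biproductl.
Qed.

(** Records which shifts of [V] are isomorphic to [W]; its series is the coefficient of 1 + t in the
    correction. *)
Definition iso_shift W V (i : int) : nat := `[< hiso W (shift V i) >].

(** An isomorphism from W to V[i] makes Hom(W, V[i]) nonzero, which happens in a bounded range of
    degrees only. *)
Lemma bounded_iso_shift W V : hid W <> 0 -> bounded (iso_shift W V).
Proof.
move=> W0; have [b bP] := hom_dim_bounded W V; exists b => i ib.
rewrite /iso_shift; case: asboolP => // Wi; have := hom_dim_id W0.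
by rewrite (hom_dim_isor _ Wi) bP.
Qed.

Lemma hiso_unshift W V i : hiso (shift W (- i)) V <-> hiso W (shift V i).
Proof.
split=> [/(hiso_shift i)|/(hiso_shift (- i)) h].
  have e := hiso_shift_add W (- i) i; rewrite addNr in e.
  by apply: hiso_trans; apply: hiso_sym; apply: hiso_trans e (hiso_shift0 W).
exact: hiso_trans h (hiso_unsh i V).
Qed.

Lemma hiso_shift_shift Z : hiso (shift (shift Z (-1)) 1) Z.
Proof.
have e := hiso_shift_add Z (-1) 1; rewrite addNr in e.
exact: hiso_trans e (hiso_shift0 Z).
Qed.

(** The count is applied to W[-i], since Hom(W[-i], V) and Hom(W, V[i]) have the same dimension. As
    X = Z[-1], dimensions and ranks both occur in degrees i - 1 and i, which sums to the factor 1 +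
    t. *)
Lemma pairing_AR_covariant W Y Z :
  indecomposable W -> has_AR_triangle (shift Z (-1)) Y Z ->
  pairing W Y + (1 + t) * series (iso_shift W Z) = (1 + t) * pairing W Z.
Proof.
move=> Wi AR; have W0 := indecomposable_id Wi.
have bI := bounded_iso_shift Z W0.
have eW (i : int) : (hdim W Y i + (iso_shift W Z (i + -1) + iso_shift W Z i) =
    hdim W Z (i + -1) + hdim W Z i)%N.
  have := AR_count_covariant AR (hiso_shift_shift Z) (indecomposable_shift (- i) Wi).
  have eqd V : hom_dim (shift W (- i)) V = hdim W V i.
    rewrite -(hom_dim_isor _ (hiso_shift0 V)) hom_dim_shift.
    by congr (hom_dim _ (shift _ _)); lia.
  have e1 : hiso (shift (shift W (- i)) 1) Z <-> hiso W (shift Z (i + -1)).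
    rewrite -hiso_unshift; have := hiso_shift_add W (- i) 1.
    have -> : - i + 1 = - (i + -1) by lia.
    by move=> e; split; apply: hiso_trans; [apply: hiso_sym|].
  have e2 := hiso_unshift W Z i.
  rewrite !eqd hdim_shiftr -addnA /iso_shift => <-; congr (_ + (_ + _))%N.
  - by congr nat_of_bool; apply/asboolP/asboolP => /e1.
  - by congr nat_of_bool; apply/asboolP/asboolP => /e2.
have /eq_series : (fun i => hdim W Y i + (iso_shift W Z (i + -1) + iso_shift W Z i))%N
  =1 (fun i => hdim W Z (i + -1) + hdim W Z i)%N := eW.
have bY := bounded_hdim W Y; have bZ := bounded_hdim W Z.
have bI' := bounded_shift (-1) bI; have bZ' := bounded_shift (-1) bZ.
rewrite !seriesD ?series_shift ?opprK ?expr1z //; last exact: boundedD.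
rewrite -![series (hdim _ _)]/(pairing _ _) !mulrDl !mul1r => e.
by rewrite [X in _ + X]addrC [RHS]addrC.
Qed.

(** The count is applied to V[i]; the degrees are now i and i + 1, so the factor is 1 + t^-1,
    cleared by multiplying with t. *)
Lemma pairing_AR_contravariant V Y Z :
  indecomposable V -> has_AR_triangle (shift Z (-1)) Y Z ->
  t * pairing Y V + (1 + t) * series (iso_shift Z V) = (1 + t) * pairing Z V.
Proof.
move=> Vi AR; have Z0 := indecomposable_id (AR_hom AR).1.
have bI := bounded_iso_shift V Z0.
have eW (i : int) : (hdim Y V i + (iso_shift Z V i + iso_shift Z V (i + 1)) =
    hdim Z V i + hdim Z V (i + 1))%N.
  have := AR_count_contravariant AR (hiso_shift_shift Z) (indecomposable_shift i Vi).
  rewrite -![hom_dim _ _]/(hdim _ V i) hdim_shiftl opprK -addnA => <-.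
  congr (_ + (_ + _))%N; congr nat_of_bool; apply/asboolP/asboolP.
  - exact: hiso_sym.
  - exact: hiso_sym.
  - by move=> h; apply: hiso_trans (hiso_shift_add V i 1) (hiso_sym h).
  by move=> h; apply: hiso_trans (hiso_sym h) (hiso_shift_add V i 1).
have /eq_series : (fun i => hdim Y V i + (iso_shift Z V i + iso_shift Z V (i + 1)))%N
  =1 (fun i => hdim Z V i + hdim Z V (i + 1))%N := eW.
have bY := bounded_hdim Y V; have bZ := bounded_hdim Z V.
have bI' := bounded_shift 1 bI; have bZ' := bounded_shift 1 bZ.
rewrite !seriesD ?series_shift //; last exact: boundedD.
rewrite -![series (hdim _ _)]/(pairing _ _) => /(congr1 ( *%R t)).
rewrite !mulrDr !mulrA -[t in t * t ^ _]expr1z -expfzDr ?t_neq0 // subrr expr0z.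
by rewrite !mul1r !mulrDl !mul1r [X in _ + X]addrC [RHS]addrC.
Qed.

(** * Labelled components *)

Section Labelled.
Variables (C : nat -> perf A) (C_lab : labelling C).

Let C_indec n : indecomposable (C n) := labelling_indec C_lab n.

Lemma labelling_covariant0 W : indecomposable W ->
  t * pairing W (C 1%N) + (1 + t) * series (iso_shift W (C 0%N)) =
  (1 + t) * pairing W (C 0%N).
Proof.
move=> Wi; rewrite -(pairing_AR_covariant Wi (labelling_AR0 C_lab)).
by rewrite pairing_shiftr opprK expr1z.
Qed.

Lemma labelling_covariantS W n : indecomposable W ->
  pairing W (C n) + t * pairing W (C n.+2) +
    (1 + t) * series (iso_shift W (C n.+1)) = (1 + t) * pairing W (C n.+1).
Proof.
move=> Wi; rewrite -(pairing_AR_covariant Wi (labelling_ARS C_lab n)).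
by rewrite (pairing_biproductr W (dsum_biproduct _ _)) pairing_shiftr opprK expr1z.
Qed.

Lemma labelling_contravariant0 V : indecomposable V ->
  pairing (C 1%N) V + (1 + t) * series (iso_shift (C 0%N) V) =
  (1 + t) * pairing (C 0%N) V.
Proof.
move=> Vi; rewrite -(pairing_AR_contravariant Vi (labelling_AR0 C_lab)).
by rewrite pairing_shiftl exprN1 mulVKf ?t_neq0.
Qed.

Lemma labelling_contravariantS V n : indecomposable V ->
  pairing (C n.+2) V + t * pairing (C n) V +
    (1 + t) * series (iso_shift (C n.+1) V) = (1 + t) * pairing (C n.+1) V.
Proof.
move=> Vi; rewrite -(pairing_AR_contravariant Vi (labelling_ARS C_lab n)).
rewrite (pairing_biproductl V (dsum_biproduct _ _)) pairing_shiftl mulrDr.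
by rewrite exprN1 mulVKf ?t_neq0 // [X in X + _]addrC.
Qed.

Lemma labelling_component n :
  same_component (C 0%N) (C n) /\ rim_distance (C n) n.
Proof. by apply/labelling_level => //; exists 0; apply/hiso_sym/hiso_shift0. Qed.

(** Every shift of [C n] has distance n from the rim, which forces m = n; a nonzero object is then
    isomorphic to none of its nontrivial shifts. *)
Lemma labelling_iso m n i : hiso (C m) (shift (C n) i) -> m = n /\ i = 0.
Proof.
move=> mni; have [_ dn] : same_component (C 0%N) (C m) /\ rim_distance (C m) n.
  by apply/labelling_level => //; exists i.
have mn := rim_distance_uniq (labelling_component m).2 dn; subst n.
by split=> //; apply: shift_aperiodic (indecomposable_id (C_indec m)) mni.
Qed.

Lemma series_iso_shift m n : series (iso_shift (C m) (C n)) = (m == n)%:R.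
Proof.
rewrite -series_delta; apply: eq_series => i; rewrite /iso_shift; congr nat_of_bool.
apply/asboolP/andP => [/labelling_iso[-> ->]|[/eqP-> /eqP->]] //.
exact/hiso_sym/hiso_shift0.
Qed.

End Labelled.

(** An isomorphism from [C m] to a shift of [D n] would place [C m] in both components. *)
Lemma series_iso_shift0 (C D : nat -> perf A) m n :
  labelling C -> labelling D -> ~ same_component (C 0%N) (D 0%N) ->
  series (iso_shift (C m) (D n)) = 0.
Proof.
move=> C_lab D_lab CD; rewrite -[RHS](series_delta false); apply: eq_series => i.
rewrite /iso_shift; case: asboolP => // Ci; case: CD.
have [CC _] := labelling_component C_lab m.
apply: same_component_trans CC (same_component_sym _).
by have [] : same_component (D 0%N) (C m) /\ rim_distance (C m) n
  by apply/labelling_level => //; exists i.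
Qed.

End Pairing.

Theorem theorem5p1 (k : closedFieldType) (A : falgType k)
    (symA : symmetric_algebra A) (nssA : no_semisimple_summand A)
    (C D : nat -> perf A)
    (C0_indec : indecomposable (C 0%N)) (C0_rim : on_rim (C 0%N))
    (D0_indec : indecomposable (D 0%N)) (D0_rim : on_rim (D 0%N))
    (C_lab : labelling C) (D_lab : labelling D) :
  [/\ forall X Y : perf A,
        same_component (C 0%N) X -> same_component (D 0%N) Y ->
        exists (m n : nat) (a b : int),
          [/\ hiso X (shift (C m) a), hiso Y (shift (D n) b) &
              pairing X Y = t ^ (a - b) * pairing (C m) (D n)],
      ~ same_component (C 0%N) (D 0%N) -> forall m n : nat,
        pairing (C m) (D n) =
          sigma m * bar (sigma n) * pairing (C 0%N) (D 0%N) &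
      forall m n : nat, let mu := maxn m n in
        pairing (C m) (C n) =
          sigma m * bar (sigma n) *
          (pairing (C 0%N) (C 0%N) -
             (1 + t) * (1 - t ^+ mu) / (1 - t ^+ mu.+1))].
Proof.
split=> [X Y CX DY|CD m n|m n mu].
- have [m Xm] := rim_distance_exists C0_rim CX.
  have [n Yn] := rim_distance_exists D0_rim DY.
  have [a Xa] := (labelling_level C_lab m X).1 (conj CX Xm).
  have [b Yb] := (labelling_level D_lab n Y).1 (conj DY Yn).
  exists m, n, a, b; split=> //.
  rewrite (pairing_iso Xa Yb) pairing_shiftl pairing_shiftr mulrA.
  by rewrite -expfzDr ?t_neq0.
- pose P m n := pairing (C m) (D n).
  have e i j : series (iso_shift (C i) (D j)) = 0 by apply: series_iso_shift0.
  have Ci := labelling_indec C_lab; have Di := labelling_indec D_lab.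
  (* Between different components every correction vanishes, which is the case d = 0. *)
  rewrite -[LHS]/(P m n) (closed_formP (d := 0) t_neq0 t_exp_neq1).
  + by rewrite /closed_form mul0r subr0 bar_sigma.
  + by rewrite -(e 0%N 0%N); apply: labelling_contravariant0.
  + move=> i; rewrite -(labelling_contravariantS C_lab i (Di 0%N)).
    by rewrite e mulr0 addr0.
  + move=> i; rewrite -(labelling_covariant0 D_lab (Ci i)).
    by rewrite e mul0rn.
  move=> i j; rewrite -(labelling_covariantS D_lab j (Ci i)).
  by rewrite e mul0rn.
pose P m n := pairing (C m) (C n).
have Ci := labelling_indec C_lab; have e := series_iso_shift C_lab.
(* Within one component the series of isomorphic shifts is 1 on the diagonal and 0 off it, which is
   the case d = 1. *)
rewrite -[LHS]/(P m n) (closed_formP (d := 1) t_neq0 t_exp_neq1).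
- by rewrite /closed_form mul1r bar_sigma.
- by have := labelling_contravariant0 C_lab (Ci 0%N); rewrite e.
- move=> i; rewrite -(labelling_contravariantS C_lab i (Ci 0%N)).
  by rewrite e mulr0 addr0.
- by move=> i; rewrite -(labelling_covariant0 C_lab (Ci i)) e.
by move=> i j; rewrite -(labelling_covariantS C_lab j (Ci i)) e.
Qed.
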